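(* For every constant $\epsilon>0$ there is a polynomial-time algorithm that, given an instance of Budgeted Red-Blue Median, outputs a feasible solution whose cost is at most $(5+\epsilon)\cdot OPT$, where $OPT$ is the minimum cost of a feasible solution of that instance.
   Context: Budgeted Red-Blue Median: we are given a finite set $C$ of clients, a finite set $\mathcal R$ of red facilities and a finite set $\mathcal B$ of blue facilities, all located in a metric space with distances $d(i,j)\ge 0$ (symmetric, satisfying the triangle inequality) for all $i,j\in C\cup\mathcal R\cup\mathcal B$, and integers $k_r\le|\mathcal R|$, $k_b\le|\mathcal B|$. A feasible solution is a pair $(R,B)$ with $R\subseteq\mathcal R$, $B\subseteq\mathcal B$, $|R|=k_r$, $|B|=k_b$; its cost is $\sum_{j\in C}\min_{i\in R\cup B} d(i,j)$. Polynomial time means polynomial in the size of the input (for fixed $\epsilon$). *)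

(* Defs.v *)
From HB Require Import structures.
From mathcomp Require Import all_boot all_order all_algebra.
From mathcomp Require Import reals.

Set Implicit Arguments.
Unset Strict Implicit.
Unset Printing Implicit Defensive.

Import Order.TTheory GRing.Theory Num.Theory.

(* Model of computation: a random access machine under the logarithmic cost
   criterion.  A program is a structured command over finitely many named,
   unbounded arrays of natural numbers; [Get a e] is cell [e] of array [a],
   and a scalar variable is an array used at one index only. *)

Inductive binop := OpAdd | OpSub | OpMul | OpDiv | OpMod | OpEq | OpLt.

Inductive expr :=
  | Const of nat
  | Get of nat & expr
  | Bin of binop & expr & expr.

Inductive cmd :=
  | Skip
  | Assign of nat & expr & expr
  | Seq of cmd & cmd
  | If of expr & cmd & cmd
  | While of expr & cmd.

Definition memory := nat -> nat -> nat.

(* [OpSub] is truncated, and division by zero is that of [divn] and [modn]. *)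
Definition binop_sem (o : binop) (x y : nat) : nat :=
  match o with
  | OpAdd => x + y
  | OpSub => x - y
  | OpMul => x * y
  | OpDiv => x %/ y
  | OpMod => x %% y
  | OpEq => x == y
  | OpLt => x < y
  end.

Fixpoint eval (m : memory) (e : expr) : nat :=
  match e with
  | Const n => n
  | Get a e1 => m a (eval m e1)
  | Bin o e1 e2 => binop_sem o (eval m e1) (eval m e2)
  end.

Definition bitlen (n : nat) : nat := (trunc_log 2 n).+1.

(* Every value produced during evaluation, operands and addresses included,
   is charged its length in binary. *)
Fixpoint ecost (m : memory) (e : expr) : nat :=
  bitlen (eval m e) +
  match e with
  | Const _ => 0
  | Get _ e1 => ecost m e1
  | Bin _ e1 e2 => ecost m e1 + ecost m e2
  end.

Definition update (m : memory) (a i v : nat) : memory :=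
  fun b j => if (b == a) && (j == i) then v else m b j.

(* [exec c m t m']: started in memory [m], the command [c] halts after time
   [t] in memory [m']. *)
Inductive exec : cmd -> memory -> nat -> memory -> Prop :=
  | ExecSkip m :
      exec Skip m 1 m
  | ExecSet m a e1 e2 :
      exec (Assign a e1 e2) m (ecost m e1 + ecost m e2)
           (update m a (eval m e1) (eval m e2))
  | ExecSeq c1 c2 m t1 m1 t2 m2 :
      exec c1 m t1 m1 -> exec c2 m1 t2 m2 ->
      exec (Seq c1 c2) m (t1 + t2) m2
  | ExecIfTrue e c1 c2 m t m' :
      eval m e != 0 -> exec c1 m t m' ->
      exec (If e c1 c2) m (ecost m e + t) m'
  | ExecIfFalse e c1 c2 m t m' :
      eval m e = 0 -> exec c2 m t m' ->
      exec (If e c1 c2) m (ecost m e + t) m'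
  | ExecWhileFalse e c m :
      eval m e = 0 ->
      exec (While e c) m (ecost m e) m
  | ExecWhileTrue e c m t1 m1 t2 m2 :
      eval m e != 0 -> exec c m t1 m1 -> exec (While e c) m1 t2 m2 ->
      exec (While e c) m (ecost m e + t1 + t2) m2.

Lemma exec_det c m t1 m1 t2 m2 :
  exec c m t1 m1 -> exec c m t2 m2 -> t1 = t2 /\ m1 = m2.
Proof.
move=> H1; elim: H1 t2 m2 => {c m t1 m1}; intros;
  match goal with H : exec _ _ ?t ?m |- _ = ?t /\ _ = ?m => inversion H end;
  subst;
  try (match goal with
  | Z : eval ?m ?e = 0, N : is_true (eval ?m ?e != 0) |- _ =>
      by rewrite Z in N
  end);
  repeat match goal with
  | IH : forall t m, exec ?c ?m1 t m -> _, E : exec ?c ?m1 _ _ |- _ =>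
      destruct (IH _ _ E); subst; clear IH
  end; by split.
Qed.

(* Array 0 holds the input; all other cells are initially 0.  Array 1 holds
   the output. *)
Definition load (w : seq nat) : memory :=
  fun a i => if a == 0 then nth 0 w i else 0.

Definition input_size (w : seq nat) : nat := \sum_(x <- w) bitlen x.

Local Open Scope ring_scope.

(* The points are 0, ..., nC + nR + nB - 1: first the clients, then the red
   facilities, then the blue ones.  Distances are rational so that an instance
   is a finite input.  Distinct points may share a location, whence a
   pseudometric. *)
Record instance := Instance {
  nC : nat;
  nR : nat;
  nB : nat;
  kr : nat;
  kb : nat;
  dist : 'M[rat]_(nC + nR + nB);
  kr_le : (kr <= nR)%N;
  kb_le : (kb <= nB)%N;
  dist_ge0 : forall x y, 0 <= dist x y;
  dist_xx : forall x, dist x x = 0;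
  dist_sym : forall x y, dist x y = dist y x;
  dist_triangle : forall x y z, dist x z <= dist x y + dist y z
}.

Definition client (I : instance) (j : 'I_(nC I)) : 'I_(nC I + nR I + nB I) :=
  lshift (nB I) (lshift (nR I) j).
Definition red (I : instance) (i : 'I_(nR I)) : 'I_(nC I + nR I + nB I) :=
  lshift (nB I) (rshift (nC I) i).
Definition blue (I : instance) (i : 'I_(nB I)) : 'I_(nC I + nR I + nB I) :=
  rshift (nC I + nR I) i.

Definition solution (I : instance) : finType :=
  ({set 'I_(nR I)} * {set 'I_(nB I)})%type.

Definition feasible (I : instance) (s : solution I) : bool :=
  (#|s.1| == kr I) && (#|s.2| == kb I).

(* The minimum of F over A; 0 when A is empty. *)
Definition min_over (T : finType) (A : {pred T}) (F : T -> rat) : rat :=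
  if [pick x in A] is Some x0 then F [arg min_(x < x0 in A) F x]%O else 0.

Lemma min_overP (T : finType) (A : {pred T}) (F : T -> rat) (x0 : T) :
  x0 \in A ->
  (exists2 x, x \in A & min_over A F = F x) /\
  (forall x, x \in A -> min_over A F <= F x).
Proof.
rewrite /min_over => Ax0; case: pickP => [x1 Ax1 | /(_ x0)]; last by rewrite Ax0.
by case: Order.TotalTheory.arg_minP => // x Ax le_x; split; first by exists x.
Qed.

Definition opened (I : instance) (s : solution I) :
    {set 'I_(nC I + nR I + nB I)} :=
  [set red i | i in s.1] :|: [set blue i | i in s.2].

(* If kr = kb = 0 no facility can be opened and the minimum below is over the
   empty set.  Its value is then immaterial: such an instance has exactly one
   feasible solution. *)
Definition cost (I : instance) (s : solution I) : rat :=
  \sum_(j < nC I) min_over (opened s) (fun i => dist I i (client j)).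

Definition OPT (I : instance) : rat := min_over (@feasible I) (@cost I).

(* The distance matrix is listed row by row, first all numerators and then all
   denominators of the reduced fractions. *)
Definition encode (I : instance) : seq nat :=
  let pts := enum 'I_(nC I + nR I + nB I) in
  [:: nC I; nR I; nB I; kr I; kb I]
    ++ [seq `|numq (dist I x y)|%N | x <- pts, y <- pts]
    ++ [seq `|denq (dist I x y)|%N | x <- pts, y <- pts].

(* A facility is selected when its output cell holds 1: red facility i has
   cell i and blue facility i has cell nR + i. *)
Definition output (I : instance) (m : memory) : solution I :=
  ([set i : 'I_(nR I) | m 1%N i == 1%N],
   [set i : 'I_(nB I) | m 1%N (nR I + i)%N == 1%N]).

(* Main.v *)
Require Import Defs.
From mathcomp Require Import all_boot all_order all_algebra all_fingroup.
From mathcomp Require Import zify ring lra.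
From mathcomp Require Import reals.

(* Local search exchanging up to [q] facilities of each colour.  Let [phi] send
   an optimal facility to its nearest local one, and call the facilities sent
   to [s] captured by [s].  Closing [s] while opening everything it captures,
   or at least the captured facility nearest to [s], changes the numbers of red
   and blue facilities by a bounded vector, provided that a facility capturing
   very many is either kept open, at the price of never opening a random small
   fraction of what it captures, or (when it captures few of its own colour and
   the other colour is captured most by such facilities) closed together with
   what it captures of its own colour.  These vectors sum to zero, so the moves
   can be grouped into blocks of bounded size that preserve both colour counts.
   Blocks closing such a facility are tested once, all others twice.  A client
   of connection costs [S] locally and [O] optimally then contributes at most
   [5 O - S] to the sum of all cost changes, up to an error that is small after
   averaging over the permutations of the optimal facilities outside the
   bounded moves, and after choosing the thresholds of few and very many
   among many scales so that clients at intermediate scales have small total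
   cost.  As no test decreases the cost by more than a factor [1 - 1/K], the
   ratio [5 + eps] follows.  Improvements by such a factor also bound the number
   of steps polynomially, distances being scaled to integers. *)

Set Implicit Arguments.
Unset Strict Implicit.
Unset Printing Implicit Defensive.

Import Order.TTheory GRing.Theory Num.Theory.

(** The constant 5 is the balance of two cases. When the local facility of a client closes, going to
    [phi] of its optimal facility costs at most [2 O] more. If that facility closes too and the
    optimal one does not open, the fallback is the captured facility nearest to it, which costs up
    to [3 O + S] more. Twice the first loss is [4 O], and a single gain [O - S] from opening the
    optimal facility completes it to [5 O - S]. The second loss taken once needs the gain
    [2 (O - S)] to reach the same total. So the second detour is affordable only if the optimal
    facility opens in a block that is tested twice. A random position ensures this if it is drawn
    from a class far larger than the set of positions in blocks tested once. The facilities of the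
    majority colour captured by large ones form such a class. Hence a large facility may close only
    if it has the other colour and takes along everything of its own colour, which leaves just that
    class for the detours. Where this would not be a bounded change, or the colour is wrong, the
    facility stays open, and the optimal facility left out in exchange is hidden in a class of many
    elements. *)

Local Open Scope ring_scope.

(* Sums in [int] may carry distinct but convertible instances, which [lia] does
   not identify before simplification. *)
Ltac int_lia := first [lia | simpl in *; first [lia | lra]].

(** * Zero-sum sequences and blocks of bounded size *)

Lemma exists_sum_gt0 (T : eqType) (f : T -> int) (s : seq T) :
  0 < \sum_(x <- s) f x -> exists2 x, x \in s & 0 < f x.
Proof.
elim: s => [|y s IHs]; first by rewrite big_nil ltxx.
rewrite big_cons /=; have [fy _|fy sgt0] := ltP 0 (f y).
  by exists y; rewrite ?mem_head.
have [|x xs fx] := IHs; first by int_lia.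
by exists x; rewrite // inE xs orbT.
Qed.

(** Greedy order: the next element is negative when the current prefix sum [p] is positive, and
    nonnegative otherwise. It exists because the remaining sum is [- p], and it moves the prefix by
    at most [K] towards zero or across it. *)
Lemma bounded_prefix_order (T : eqType) (f : T -> int) (K : nat) (s : seq T) (p : int) :
  {in s, forall x, `|f x| <= K%:Z} -> `|p| <= K%:Z -> p + \sum_(x <- s) f x = 0 ->
  exists2 s', perm_eq s s' &
    forall i, `|p + \sum_(x <- take i s') f x| <= K%:Z.
Proof.
have [n] := ubnP (size s); elim: n s p => // n IHn s p.
case: s => [|a s] sz fK pK sum0.
  by exists [::] => // i; rewrite /= big_nil addr0.
have [x xs px] : exists2 x, x \in a :: s & `|p + f x| <= K%:Z.
  have [p0|p0] := ltP 0 p.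
    have [|x xs fx] := @exists_sum_gt0 _ (fun x => - f x) (a :: s).
      by rewrite sumrN /=; move: sum0 => /= sum0; int_lia.
    by exists x => //; have := fK x xs; int_lia.
  have [fa|fa] := ltP (f a) 0; last first.
    by exists a; rewrite ?mem_head //; have := fK a (mem_head _ _); int_lia.
  have [|x xs fx] := @exists_sum_gt0 _ f s.
    by move: sum0; rewrite big_cons /=; int_lia.
  have xas : x \in a :: s by rewrite inE xs orbT.
  by exists x => //; have := fK x xas; int_lia.
have ps := perm_to_rem xs.
have [| | | |s' ps' s'K] := IHn (rem x (a :: s)) (p + f x).
- by move: (perm_size ps) sz => /= ->; rewrite /= ltnS.
- by move=> y /mem_rem ys; apply: fK.
- exact: px.
- by move: sum0; rewrite (perm_big _ ps) big_cons addrA.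
exists (x :: s'); first by rewrite (permPl ps) perm_cons.
by case=> [|i] /=; rewrite ?big_nil ?addr0 // big_cons addrA.
Qed.

(** Pigeonhole: the prefix sums take at most [2 K + 1] values, so two prefixes of different lengths
    have the same sum, and the stretch between them is one part. Only lengths below [size s] are
    compared, which keeps the other part nonempty. *)
Lemma zero_sum_split (T : eqType) (f : T -> int) (K : nat) (s : seq T) :
  {in s, forall x, `|f x| <= K%:Z} -> \sum_(x <- s) f x = 0 ->
  ((2 * K).+1 < size s)%N ->
  exists s1 s2, [/\ perm_eq s (s1 ++ s2), (0 < size s1)%N, (0 < size s2)%N,
     \sum_(x <- s1) f x = 0 & \sum_(x <- s2) f x = 0].
Proof.
move=> fK sum0 sz.
have [||s' ps s'K] := @bounded_prefix_order T f K s 0 fK; rewrite ?normr0 ?add0r //.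
have sz' := perm_size ps.
pose g (i : nat) : int := \sum_(x <- take i s') f x.
pose h (i : 'I_(size s)) : 'I_(2 * K).+1 := inord (absz (g i + K%:Z)).
have hE i : (h i : nat) = absz (g i + K%:Z).
  by rewrite /h inordK //; have := s'K i; rewrite add0r -/(g i); int_lia.
have /injectivePn[i0 [j0 ne_ij eq_h]] : ~~ injectiveb h.
  apply/negP => /injectiveP /leq_card; rewrite !card_ord; int_lia.
have [i [j [lt_ij lt_js eq_g]]] : exists i j : nat,
    [/\ (i < j)%N, (j < size s)%N & g i = g j].
  have eg : g i0 = g j0.
    move/(congr1 (@nat_of_ord _)): eq_h; rewrite !hE.
    by have := s'K i0; have := s'K j0; rewrite !add0r -/(g i0) -/(g j0); int_lia.
  have [lt|lt|eq] := ltngtP i0 j0.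
  - by exists i0, j0; split.
  - by exists j0, i0; split.
  - by case/eqP: ne_ij; apply: val_inj.
have tj : take j s' = take i s' ++ drop i (take j s').
  by rewrite -{1}(cat_take_drop i (take j s')) take_takel // ltnW.
exists (drop i (take j s')), (take i s' ++ drop j s'); split.
- rewrite (permPl ps) -{1}(cat_take_drop j s') {1}tj -catA perm_catCA.
  by rewrite perm_refl.
- by rewrite size_drop size_take_min -sz'; int_lia.
- by rewrite size_cat size_drop -sz'; int_lia.
- have: g j = g i + \sum_(x <- drop i (take j s')) f x by rewrite {1}/g {1}tj big_cat.
  by rewrite eq_g -[LHS]addr0 => /addrI <-.
- have: \sum_(x <- s') f x = 0 by rewrite -(perm_big _ ps).
  rewrite -{1}(cat_take_drop j s') !big_cat /= -/(g i) -/(g j); int_lia.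
Qed.

Lemma zero_sum_partition1 (T : eqType) (f : T -> int) (K : nat) (s : seq T) :
  {in s, forall x, `|f x| <= K%:Z} -> \sum_(x <- s) f x = 0 ->
  exists2 bs, perm_eq s (flatten bs) &
    {in bs, forall b, [/\ (0 < size b)%N, (size b <= (2 * K).+1)%N
                       & \sum_(x <- b) f x = 0]}.
Proof.
have [n] := ubnP (size s); elim: n s => // n IHn s szn fK sum0.
have [sz|sz] := leqP (size s) (2 * K).+1.
  case: s szn fK sum0 sz => [|a s] szn fK sum0 sz; first by exists [::].
  by exists [:: a :: s]; rewrite /= ?cats0 // => b; rewrite inE => /eqP->.
have [s1 [s2 [ps s1_gt0 s2_gt0 sum1 sum2]]] := zero_sum_split fK sum0 sz.
have szs : size s = (size s1 + size s2)%N by rewrite (perm_size ps) size_cat.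
have [||bs1 p1 b1] := IHn s1 _ _ sum1; first by int_lia.
  by move=> x xs; apply: fK; rewrite (perm_mem ps) mem_cat xs.
have [||bs2 p2 b2] := IHn s2 _ _ sum2; first by int_lia.
  by move=> x xs; apply: fK; rewrite (perm_mem ps) mem_cat xs orbT.
exists (bs1 ++ bs2); first by rewrite flatten_cat (permPl ps) perm_cat.
by move=> b; rewrite mem_cat => /orP[/b1|/b2].
Qed.

(** Grouping by one coordinate gives blocks of at most [2 K + 1] items, whose other coordinate is at
    most [K (2 K + 1)]. Grouping these blocks for that larger bound gives the second factor. *)
Definition block_bound (K : nat) : nat :=
  ((2 * K).+1 * (2 * (K * (2 * K).+1)).+1)%N.

Lemma big_flatten_seq (T : eqType) (f : T -> int) (bs : seq (seq T)) :
  \sum_(x <- flatten bs) f x = \sum_(b <- bs) \sum_(x <- b) f x.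
Proof. by elim: bs => [|b bs IH]; rewrite ?big_nil //= big_cat big_cons IH. Qed.

(* The one-dimensional partition is applied twice: to the items for [f], then
   to the resulting blocks for [g]. *)
Lemma zero_sum_partition2 (T : eqType) (f g : T -> int) (K : nat) (s : seq T) :
  {in s, forall x, `|f x| <= K%:Z} -> {in s, forall x, `|g x| <= K%:Z} ->
  \sum_(x <- s) f x = 0 -> \sum_(x <- s) g x = 0 ->
  exists2 bs, perm_eq s (flatten bs) &
    {in bs, forall b, [/\ (0 < size b)%N, (size b <= block_bound K)%N,
                       \sum_(x <- b) f x = 0 & \sum_(x <- b) g x = 0]}.
Proof.
move=> fK gK f0 g0.
have [bs ps bsP] := zero_sum_partition1 fK f0.
have mem_bs b x : b \in bs -> x \in b -> x \in s.
  by move=> bb xb; rewrite (perm_mem ps); apply/flattenP; exists b.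
have gK' : {in bs, forall b, `|\sum_(x <- b) g x| <= (K * (2 * K).+1)%N%:Z}.
  move=> b bb; have [_ szb _] := bsP b bb.
  apply: (@le_trans _ _ (\sum_(x <- b) K%:Z)).
    apply: (le_trans (ler_norm_sum _ _ _)); rewrite big_seq [leRHS]big_seq.
    by apply: ler_sum => x xb; apply/gK/(mem_bs b).
  rewrite big_const_seq count_predT iter_addr addr0 -mulr_natr natz.
  by rewrite PoszM ler_wpM2l.
have [|bbs pbs bbsP] := @zero_sum_partition1 _ (fun b => \sum_(x <- b) g x) _ bs gK'.
  by rewrite -big_flatten_seq -(perm_big _ ps).
exists (map flatten bbs).
  have -> : flatten (map flatten bbs) = flatten (flatten bbs).
    by elim: (bbs) => //= c cs ->; rewrite flatten_cat.
  by rewrite (permPl ps); apply: perm_flatten.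
move=> _ /mapP[c cbbs ->].
have [c_gt0 szc sumc] := bbsP c cbbs.
have cbs b : b \in c -> b \in bs.
  by move=> bc; rewrite (perm_mem pbs); apply/flattenP; exists c.
split.
- case: c c_gt0 cbs {szc sumc cbbs} => //= b c _ cbs.
  by rewrite size_cat ltn_addr //; have [] := bsP b (cbs b (mem_head _ _)).
- rewrite size_flatten /block_bound mulnC.
  apply: (@leq_trans (size c * (2 * K).+1)); last by rewrite leq_mul2r szc orbT.
  elim: c cbs {c_gt0 szc sumc cbbs} => //= b c IH cbs.
  rewrite mulSn leq_add //; first by have [] := bsP b (cbs b (mem_head _ _)).
  by apply: IH => x xc; apply: cbs; rewrite inE xc orbT.
- rewrite big_flatten_seq big_seq big1 // => b /cbs /bsP[] //.
- by rewrite big_flatten_seq.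
Qed.

(** Averaging over the permutations that preserve a colouring *)

Section ClassPreserving.

Variables (F : finType) (E : eqType) (kappa : F -> E).

Definition class_perms : {set {perm F}} :=
  [set u : {perm F} | [forall x, kappa (u x) == kappa x]].

Lemma class_permsP (u : {perm F}) :
  reflect (forall x, kappa (u x) = kappa x) (u \in class_perms).
Proof. by rewrite inE; apply: 'forall_eqP. Qed.

Lemma class_perms1 : 1%g \in class_perms.
Proof. by apply/class_permsP => x; rewrite perm1. Qed.

(** Composition with the transposition of [x] and [y] is injective, preserves classes because [x]
    and [y] share theirs, and turns [u o = x] into [u o = y]. *)
Lemma card_class_perms_to (o x y : F) : kappa x = kappa y ->
  (#|[set u in class_perms | u o == x]| <= #|[set u in class_perms | u o == y]|)%N.
Proof.
move=> kxy; rewrite -(card_imset _ (@mulIg _ (tperm x y))).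
apply/subset_leq_card/subsetP => v /imsetP[u].
rewrite inE => /andP[/class_permsP uG /eqP uo] ->.
rewrite inE permM uo tpermL eqxx andbT; apply/class_permsP => z.
by rewrite permM; case: tpermP => [Eu|Eu|_ _]; [rewrite -kxy -Eu|rewrite kxy -Eu|]; rewrite uG.
Qed.

(** The image of [o] under a random class-preserving permutation is uniform on the class of [o].
    This is the resulting bound on the probability of meeting [A], free of division. *)
Lemma class_perms_hit (A : {set F}) (o : F) :
  (#|[set u in class_perms | u o \in A]| * #|[set x | kappa x == kappa o]|
     <= #|class_perms| * #|A|)%N.
Proof.
set Cl := [set x | kappa x == _].
pose n0 := #|[set u in class_perms | u o == o]|.
have cardA (B : {set F}) :
    #|[set u in class_perms | u o \in B]| = (#|B :&: Cl| * n0)%N.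
  rewrite -sum1_card (partition_big (fun u : {perm F} => u o) (mem (B :&: Cl))) /=.
    rewrite -sum_nat_const; apply: eq_bigr => x; rewrite !inE => /andP[xB /eqP kx].
    rewrite sum1_card; apply/eqP; rewrite eqn_leq.
    have -> : #|[pred u in [set u in class_perms | u o \in B] | u o == x]| =
              #|[set u in class_perms | u o == x]|.
      by apply: eq_card => u; rewrite !inE -andbA; case: eqP => [->|]; rewrite ?xB ?andbF.
    by rewrite !card_class_perms_to.
  by move=> u; rewrite !inE -/class_perms => /andP[/forallP/(_ o)/eqP -> ->]; rewrite eqxx.
have -> : #|class_perms| = (#|Cl| * n0)%N.
  rewrite -[Cl]setTI -cardA; apply: eq_card => u.
  by rewrite [in RHS]inE in_setT andbT.
rewrite cardA -mulnA [(n0 * _)%N]mulnC [leqRHS]mulnC leq_mul2r.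
by rewrite subset_leq_card ?orbT // subsetIl.
Qed.

End ClassPreserving.

(** Local optima *)

Lemma exists_subset_card (T : finType) (A : {set T}) (n : nat) :
  (n <= #|A|)%N -> exists2 B : {set T}, B \subset A & #|B| = n.
Proof.
move=> nA; exists [set x in take n (enum A)].
  by apply/subsetP => x; rewrite inE => /mem_take; rewrite mem_enum.
rewrite cardsE (card_uniqP _) ?take_uniq ?enum_uniq //.
by rewrite size_takel // -cardE.
Qed.

Lemma card_fibers_seq (T : finType) (U : eqType) (A : {set T}) (g : T -> U) (b : seq U) :
  uniq b ->
  #|[set x in A | g x \in b]| = (\sum_(i <- b) #|[set x in A | g x == i]|)%N.
Proof.
elim: b => [|i b IHb] /=.
  by rewrite big_nil => _; apply/eqP; rewrite cards_eq0; apply/eqP/setP => x; rewrite !inE andbF.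
case/andP=> ib ub; rewrite big_cons -IHb // -cardsUI.
have -> : [set x in A | g x == i] :&: [set x in A | g x \in b] = set0.
  apply/setP => x; rewrite !inE; apply/negbTE; rewrite !negb_and.
  by case: (eqVneq (g x) i) => [->|]; rewrite ?ib ?orbT.
by rewrite cards0 addn0; apply: eq_card => x; rewrite !inE -andb_orr.
Qed.

(** An item lies in at most one block. For a client this collapses a sum over all blocks to the
    block opening its optimal facility and the block closing its local one. *)
Lemma sum_block (U : eqType) (V : nmodType) (bs : seq (seq U)) (i : U) (b0 : seq U)
    (f : seq U -> V) :
  uniq (flatten bs) -> b0 \in bs -> i \in b0 ->
  \sum_(b <- bs | i \in b) f b = f b0.
Proof.
elim: bs => //= b bs IH; rewrite cat_uniq => /and3P[_ dis ubs].
rewrite inE big_cons => /orP[/eqP e ib|b0bs ib0].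
  rewrite -e ib big_seq_cond big1 ?addr0 // => c /andP[cbs ic].
  by case/negP: dis; apply/hasP; exists i; [apply/flattenP; exists c | rewrite -e].
rewrite ifN ?IH //; apply: contra dis => ib.
by apply/hasP; exists i; [apply/flattenP; exists b0 | ].
Qed.

Section LocalOptimum.

Variables (R : realFieldType) (F C : finType) (P : Type) (d : P -> P -> R).
Variables (pF : F -> P) (pC : C -> P) (col : F -> bool).
Hypothesis d_ge0 : forall x y, 0 <= d x y.
Hypothesis d_sym : forall x y, d x y = d y x.
Hypothesis d_tri : forall x y z, d x z <= d x y + d y z.

Variables (S O : {set F}) (sg og : C -> F) (phi cent : F -> F).
Hypothesis sgS : forall j, sg j \in S.
Hypothesis ogO : forall j, og j \in O.
Hypothesis card_col : forall c,
  #|[set f in S | col f == c]| = #|[set f in O | col f == c]|.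
Hypothesis phiS : forall o, phi o \in S.
Hypothesis phi_min : forall o s, s \in S ->
  d (pF o) (pF (phi o)) <= d (pF o) (pF s).
Hypothesis centO : forall o, o \in O -> cent (phi o) \in O.
Hypothesis phi_cent : forall o, o \in O -> phi (cent (phi o)) = phi o.
Hypothesis cent_min : forall o, o \in O ->
  d (pF (phi o)) (pF (cent (phi o))) <= d (pF (phi o)) (pF o).

Local Notation Sj j := (d (pF (sg j)) (pC j)).
Local Notation Oj j := (d (pF (og j)) (pC j)).

(** The detour runs through [og j]: from there [phi (og j)] is no further than [sg j], hence within
    [Oj j + Sj j]. *)
Lemma dist_phi_og (j : C) : d (pF (phi (og j))) (pC j) - Sj j <= 2 * Oj j.
Proof.
have h1 := d_tri (pF (phi (og j))) (pF (og j)) (pC j).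
have h2 := phi_min (og j) (sgS j).
have h3 := d_tri (pF (og j)) (pC j) (pF (sg j)).
rewrite (d_sym (pF (phi _)) (pF (og j))) in h1.
rewrite (d_sym (pC j) (pF (sg j))) in h3.
lra.
Qed.

(** The detour continues from [phi (og j)] to its centre, which is no further from it than [og j]
    is. *)
Lemma dist_cent_og (j : C) :
  d (pF (cent (phi (og j)))) (pC j) - Sj j <= 3 * Oj j + Sj j.
Proof.
have h1 := d_tri (pF (cent (phi (og j)))) (pF (phi (og j))) (pC j).
have h2 := cent_min (ogO j).
have h3 := dist_phi_og j.
have h4 := phi_min (og j) (sgS j).
have h5 := d_tri (pF (og j)) (pC j) (pF (sg j)).
rewrite (d_sym (pF (cent _)) (pF (phi _))) in h1.
rewrite (d_sym (pF (phi _)) (pF (og j))) in h2.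
rewrite (d_sym (pC j) (pF (sg j))) in h5.
lra.
Qed.

(* [D] and [D'] are the degree thresholds between small, medium and large
   facilities, and [c1] is the colour of most optimal facilities captured by
   large ones. *)
Variables (D D' M : nat) (c1 : bool).

(** * Classification of facilities by degree and colour *)

Definition deg (s : F) : nat := #|[set o in O | phi o == s]|.
Definition small (s : F) : bool := (deg s <= D)%N.
Definition medium (s : F) : bool := (D < deg s <= D')%N.
Definition large (s : F) : bool := (D' < deg s)%N.
Definition own (s : F) : {set F} := [set o in O | (phi o == s) && (col o == col s)].
(** A large facility is either [kept] or [cross]. Opening all of [own s] is a bounded change only if
    it has at most [D] elements, and the captured facilities outside [own s] have colour [c1] only
    if [s] has not. *)
Definition heavy (s : F) : bool := [&& large s, col s != c1 & (D < #|own s|)%N].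
Definition cross (s : F) : bool := [&& large s, col s != c1 & (#|own s| <= D)%N].
Definition kept (s : F) : bool := large s && ((col s == c1) || (D < #|own s|)%N).

(** The facilities whose opening is tied to the closing of [phi o]. Whenever [phi o] is not kept
    they include its centre, the last resort of a client, and they number at most [D + 1]. *)
Definition attached (o : F) : bool :=
  (o \in O) &&
  [|| small (phi o), medium (phi o) && (o == cent (phi o))
   | cross (phi o) && ((o == cent (phi o)) || (col o == col (phi o)))].

Definition floating : {set F} := [set o in O | ~~ attached o].
Definition Xset : {set F} := [set o in floating | large (phi o) && (col o == c1)].

(** The nontrivial classes are [Xset] and, for each heavy [s], the set [own s]: with two colours,
    differing from [c1] means having the colour of [s]. All other facilities are fixed. *)
Definition kappa (o : F) : option (F + F) :=
  if o \in Xset then None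
  else if [&& o \in O, heavy (phi o) & col o != c1] then Some (inl (phi o))
  else Some (inr o).

Local Notation G := (class_perms kappa).

Hypothesis le_DD' : (D <= D')%N.

Lemma largeN_small s : large s -> small s = false.
Proof. rewrite /large /small => h; apply/negbTE; rewrite -ltnNge; lia. Qed.

Lemma largeN_medium s : large s -> medium s = false.
Proof. by rewrite /large /medium [(_ <= D')%N]leqNgt => ->; rewrite andbF. Qed.

Lemma heavy_kept s : heavy s -> kept s.
Proof. by rewrite /heavy /kept => /and3P[-> _ ->]; rewrite orbT. Qed.

Lemma keptN_attached o : attached o -> ~~ kept (phi o).
Proof.
rewrite /kept; case: (boolP (large (phi o))) => //= lg.
rewrite /attached (largeN_small lg) (largeN_medium lg) /cross lg /=.
by case/and3P => _ /andP[/negbTE->]; rewrite -leqNgt.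
Qed.

Lemma heavy_floating o : o \in O -> heavy (phi o) -> o \in floating.
Proof.
move=> oO h; rewrite inE oO /=; apply/negP => /keptN_attached.
by rewrite heavy_kept.
Qed.

Variant kappa_spec (u : {perm F}) (o : F) : Type :=
  | KappaX of o \in Xset & u o \in Xset
  | KappaH of o \notin Xset & o \in O & heavy (phi o) & col o != c1 & u o \in O
      & phi (u o) = phi o & col (u o) != c1
  | KappaFix of o \notin Xset & ~~ [&& o \in O, heavy (phi o) & col o != c1] & u o = o.

Lemma class_permP (u : {perm F}) (o : F) : u \in G -> kappa_spec u o.
Proof.
move=> /class_permsP/(_ o)/esym; rewrite /kappa.
case: ifPn => [oX|oX].
  by case: ifPn => [uX _|_]; [constructor 1 | case: ifP].
case: ifPn => [/and3P[oO hv co]|no].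
  case: ifPn => // uX; case: ifPn => // /and3P[uO huv cu] [e].
  by constructor 2.
by case: ifPn => // uX; case: ifPn => // _ [e]; constructor 3.
Qed.

Lemma Xset_floating o : o \in Xset -> o \in floating.
Proof. by rewrite inE => /andP[]. Qed.

Lemma class_perm_floating (u : {perm F}) (o : F) : u \in G -> o \in floating ->
  u o \in floating /\ col (u o) = col o.
Proof.
move=> uG of_; case: (class_permP o uG) => [oX uX|_ oO hv co uO pu cu|_ _ ->] //.
  split; first exact: Xset_floating.
  by move: oX uX; rewrite !inE => /and3P[_ _ /eqP->] /and3P[_ _ /eqP->].
split; first by apply: heavy_floating; rewrite ?pu.
by move: co cu; case: (col o) (col (u o)) (c1) => [] [] [].
Qed.

Lemma class_perm_attached (u : {perm F}) (o : F) : u \in G -> attached o -> u o = o.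
Proof.
move=> uG ao; case: (class_permP o uG) => //.
  by move=> /Xset_floating; rewrite inE ao andbF.
by move=> _ oO hv _ _ _ _; have := heavy_floating oO hv; rewrite inE ao andbF.
Qed.

(* The item [inl s] closes [s] and opens the facilities attached to [s]; the
   item [inr x] opens the facility that a permutation [u] puts at [x]. *)
Definition pos (u : {perm F}) (o : F) : F + F :=
  if attached o then inl (phi o) else inr (u o).

Definition opening (u : {perm F}) (b : seq (F + F)) : {set F} :=
  [set o in O | pos u o \in b].
Definition closing (b : seq (F + F)) : {set F} := [set s in S | inl s \in b].

(** The permutation [u] maps what is opened under [u] injectively, with its colour, into what is
    opened under the identity. So blocks balanced for the identity exceed no colour count under any
    [u]. *)
Lemma card_opening_perm (u : {perm F}) b c : u \in G ->
  (#|[set o in opening u b | col o == c]| <= #|[set o in opening 1 b | col o == c]|)%N.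
Proof.
move=> uG; rewrite -(card_imset _ (@perm_inj _ u)).
apply/subset_leq_card/subsetP => _ /imsetP[o + ->]; rewrite !inE => /andP[/andP[oO pb] co].
have [ao|nao] := boolP (attached o).
  by rewrite class_perm_attached // oO co andbT /=; move: pb; rewrite /pos ao.
have ofl : o \in floating by rewrite inE oO.
have [] := class_perm_floating uG ofl; rewrite inE => /andP[uO una] ->.
by rewrite uO co andbT /=; move: pb; rewrite /pos (negbTE nao) (negbTE una) perm1.
Qed.

Definition vec (c : bool) (i : F + F) : int :=
  #|[set o in [set o in O | col o == c] | pos 1 o == i]|%:Z
  - #|[set s in [set s in S | col s == c] | inl s == i]|%:Z.

(** A small facility captures at most [D], a medium one has only its centre attached, and a cross
    one its centre and the at most [D] elements of [own s]. *)
Lemma card_attached_le s : ~~ kept s ->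
  (#|[set o in O | attached o && (phi o == s)]| <= D.+1)%N.
Proof.
move=> ks; have [sm|nsm] := boolP (small s).
  apply: leq_trans (leqW sm); apply/subset_leq_card/subsetP => o.
  by rewrite !inE => /and3P[-> _ ->].
apply: (@leq_trans #|cent s |: (if cross s then own s else set0)|).
  apply/subset_leq_card/subsetP => o; rewrite !inE => /and3P[oO + /eqP ps].
  rewrite /attached ps (negbTE nsm) oO /= => /orP[/andP[_ ->] //|].
  by case/andP => -> /orP[-> // | co]; rewrite !inE oO ps eqxx co orbT.
apply: leq_trans (leq_card_setU _ _) _; rewrite cards1 add1n ltnS.
by case: ifP => [/and3P[]|]; rewrite ?cards0.
Qed.

Lemma vec_bound c (i : F + F) :
  (if i is inl s then ~~ kept s else true) -> `|vec c i| <= D.+1%:Z.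
Proof.
rewrite /vec => hi; set A := [set o in _ | pos 1 o == i]; set B := [set s in _ | inl s == i].
have hA : (#|A| <= D.+1)%N.
  case: i @A @B hi => [s|x] A B hi.
    apply: leq_trans (card_attached_le hi); apply/subset_leq_card/subsetP => o.
    rewrite !inE /pos => /andP[/andP[-> _]]; case: (attached o) => //= /eqP[e]; apply/eqP; exact: e.
  apply: (@leq_trans #|[set x]|); last by rewrite cards1.
  apply/subset_leq_card/subsetP => o; rewrite !inE /pos => /andP[_].
  by case: ifP => // _ /eqP[<-]; rewrite perm1.
have hB : (#|B| <= 1)%N.
  case: i @A @B hA {hi} => [s|x] A B _.
    rewrite -(cards1 s); apply/subset_leq_card/subsetP => o; rewrite !inE => /andP[_].
    by move/eqP => [->].
  rewrite (_ : B = set0) ?cards0 //; apply/setP => o.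
  by rewrite !inE andbF.
by lia.
Qed.

Lemma sum_vec c (b : seq (F + F)) : uniq b ->
  \sum_(i <- b) vec c i =
    #|[set o in opening 1 b | col o == c]|%:Z - #|[set s in closing b | col s == c]|%:Z.
Proof.
move=> ub; rewrite /vec big_split /= sumrN.
rewrite -!(big_morph Posz PoszD (erefl _)) -!card_fibers_seq //.
by congr (_%:Z - _%:Z); apply: eq_card => o; rewrite !inE andbAC.
Qed.

Definition lset : {set F} := [set s in S | large s].

Hypothesis c1_major :
  (#|[set o in O | large (phi o) && (col o != c1)]|
     <= #|[set o in O | large (phi o) && (col o == c1)]|)%N.

Local Notation L := (block_bound D.+1).

Hypothesis M_gt0 : (0 < M)%N.
Hypothesis D'_big : (2 * M * L.+1 + 2 <= D')%N.

(** Each large facility captures more than [D'], and at least half of all these captures have colour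
    [c1]. Of those, only centres can be attached, since what else is attached to a cross facility
    has the other colour. Hence [(D' - 2) #|lset| <= 2 #|Xset|], which explains the lower bound
    required of [D']. *)
Lemma card_lset : (M * L.+1 * #|lset| <= #|Xset|)%N.
Proof.
set beta := #|[set o in O | large (phi o) && (col o == c1)]|.
have h1 : (D' * #|lset| <= 2 * beta)%N.
  apply: (@leq_trans #|[set o in O | large (phi o)]|).
    rewrite mulnC -sum_nat_const.
    apply: (@leq_trans (\sum_(s in lset) deg s)).
      by apply: leq_sum => s; rewrite inE => /andP[_ /ltnW].
    rewrite -[leqRHS]sum1_card [leqRHS](partition_big phi (mem lset)) /=; last first.
      by move=> o; rewrite inE => /andP[_ lo] /=; rewrite inE phiS lo.
    apply: leq_sum => s; rewrite inE => /andP[_ ls].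
    rewrite sum1_card; apply/subset_leq_card/subsetP => o.
    rewrite [in X in X -> _]inE => /andP[oO /eqP e].
    by rewrite unfold_in /= inE oO e ls eqxx.
  rewrite mul2n -addnn; apply: (@leq_trans (beta + #|[set o in O | large (phi o) && (col o != c1)]|)).
    apply: leq_trans (leq_card_setU _ _); apply/subset_leq_card/subsetP => o.
    by rewrite !inE => /andP[-> ->]; rewrite orbN.
  by rewrite leq_add2l.
have h2 : (beta <= #|Xset| + #|lset|)%N.
  apply: (@leq_trans (#|Xset| + #|[set cent s | s in lset]|)); last first.
    by rewrite leq_add2l leq_imset_card.
  apply: leq_trans (leq_card_setU _ _); apply/subset_leq_card/subsetP => o.
  rewrite !inE => /and3P[oO lo /eqP co]; rewrite oO lo co eqxx !andbT.
  case: (boolP (attached o)) => //=; rewrite /attached (largeN_small lo) (largeN_medium lo) oO /=.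
  case/andP => /and3P[_ cs _] /orP[/eqP-> |]; last by rewrite co eq_sym (negbTE cs).
  by apply: imset_f; rewrite inE phiS.
nia.
Qed.

Definition pick_own (s : F) : F := odflt s [pick o in own s].

Lemma pick_ownP s : heavy s -> [/\ pick_own s \in O, phi (pick_own s) = s & col (pick_own s) = col s].
Proof.
rewrite /pick_own => /and3P[_ _ h]; case: pickP => [o|n0] /=.
  by rewrite inE => /and3P[-> /eqP-> /eqP->].
by move: h; rewrite (eq_card0 n0).
Qed.

(** A kept facility never closes, so some optimal facility of its colour must never open. For colour
    [c1] it is taken from [Xset], which is large enough; for a heavy facility [s] it is one element
    of [own s]. Either way the dropped part of a class is a small fraction of it. *)
Lemma exists_dropped : exists Dr : {set F},
  [/\ Dr \subset floating,
      (forall c, #|[set o in Dr | col o == c]| = #|[set s in S | kept s && (col s == c)]|),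
      (#|Dr :&: Xset| <= #|lset|)%N,
      (forall s, heavy s -> #|Dr :&: own s| <= 1)%N
    & forall o, o \in Dr -> o \notin Xset -> [&& o \in O, heavy (phi o) & col o != c1]].
Proof.
pose lb := [set s in S | large s && (col s == c1)].
have lbl : lb \subset lset.
  by apply/subsetP => s; rewrite !inE => /and3P[-> ->].
have lbX : (#|lb| <= #|Xset|)%N.
  apply: leq_trans card_lset; apply: leq_trans (subset_leq_card lbl) _.
  by rewrite leq_pmull // muln_gt0 M_gt0.
have [Dx DxX cDx] := exists_subset_card lbX.
pose hs := [set s in S | heavy s].
pose Dh := pick_own @: hs.
have DhP o : o \in Dh -> [/\ o \in O, heavy (phi o), pick_own (phi o) = o & col o != c1].
  case/imsetP => s; rewrite inE => /andP[sS hv] ->.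
  have [pO pp pc] := pick_ownP hv; rewrite pp pc; split=> //.
  by case/and3P: hv.
have DxP o : o \in Dx -> o \in Xset by apply: (subsetP DxX).
have XsetC o : o \in Xset -> col o = c1 by rewrite inE => /and3P[_ _ /eqP].
exists (Dx :|: Dh); split.
- apply/subsetP => o; rewrite inE => /orP[/DxP/Xset_floating //|/DhP[oO hv _ _]].
  exact: heavy_floating.
- move=> c; have [->|/negbTE nc] := eqVneq c c1.
    transitivity #|Dx|.
      apply: eq_card => o; rewrite !inE.
      apply/andP/idP => [[/orP[//|/DhP[_ _ _ /negbTE->]] //]|oD].
      by rewrite oD (XsetC _ (DxP _ oD)).
    rewrite cDx; apply: eq_card => s; rewrite !inE /kept.
    by case: (col s == c1); rewrite ?andbF ?andbT.
  transitivity #|Dh|.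
    apply: eq_card => o; rewrite !inE.
    apply/andP/idP => [[/orP[/DxP/XsetC e|//]]|oD].
      by rewrite e eq_sym nc.
    have [_ _ _ cc] := DhP _ oD; rewrite oD orbT; split=> //.
    by move: cc nc; case: (col o) (c1) (c) => [] [] [].
  rewrite card_in_imset.
    apply: eq_card => s; rewrite !inE /heavy /kept -andbA; congr (_ && (_ && _)).
    by move: nc; case: (col s) (c1) (c) (_ < _)%N => [] [] [] [].
  move=> s s'; rewrite !inE => /andP[_ h1] /andP[_ h2] e.
  by have [_ <- _] := pick_ownP h1; have [_ <- _] := pick_ownP h2; rewrite e.
- apply: leq_trans (subset_leq_card lbl); rewrite -cDx.
  apply/subset_leq_card/subsetP => o; rewrite !inE => /andP[/orP[//|/DhP[_ _ _ nc]]].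
  by rewrite (negbTE nc) !andbF.
- move=> s hv; rewrite -(cards1 (pick_own s)); apply/subset_leq_card/subsetP => o.
  rewrite !inE => /and4P[/orP[/DxP/XsetC co|/DhP[_ _ po _]] _ /eqP ps /eqP cs].
    by case/and3P: hv => _; rewrite -cs co eqxx.
  by rewrite -ps po.
- move=> o; rewrite inE => /orP[/DxP-> // |/DhP[-> -> _ ->]] //.
Qed.

(** * Blocks of items and the solutions they test *)

Section Blocks.

Variable Dr : {set F}.
Hypothesis Dr_floating : Dr \subset floating.
Hypothesis card_Dr : forall c,
  #|[set o in Dr | col o == c]| = #|[set s in S | kept s && (col s == c)]|.
Hypothesis card_Dr_X : (#|Dr :&: Xset| <= #|lset|)%N.
Hypothesis card_Dr_own : forall s, heavy s -> (#|Dr :&: own s| <= 1)%N.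
Hypothesis Dr_heavy : forall o, o \in Dr -> o \notin Xset ->
  [&& o \in O, heavy (phi o) & col o != c1].

Definition is_item (i : F + F) : bool :=
  match i with
  | inl s => (s \in S) && ~~ kept s
  | inr x => (x \in floating) && (x \notin Dr)
  end.

Definition items : {set F + F} := [set i | is_item i].

(** All items together open [O] without [Dr] and close [S] without the kept facilities. In each
    colour [O] and [S] have equal counts, and so do the two exceptions. *)
Lemma sum_vec_items c : \sum_(i <- enum items) vec c i = 0.
Proof.
rewrite sum_vec ?enum_uniq //.
pose Oc := [set o in O | col o == c]; pose Sc := [set s in S | col s == c].
have -> : [set o in opening 1 (enum items) | col o == c] =
          Oc :\: [set o in Dr | col o == c].
  apply/setP => o; rewrite !inE mem_enum inE /pos.
  case: (boolP (attached o)) => [ao|nao] /=.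
    have /negbTE -> : o \notin Dr.
      by apply/negP => /(subsetP Dr_floating); rewrite inE ao andbF.
    by rewrite phiS keptN_attached //= andbT.
  rewrite perm1 inE nao andbT; case: (o \in O); rewrite ?andbF //=.
  by case: (col o == c); rewrite ?andbF ?andbT.
have -> : [set s in closing (enum items) | col s == c] =
          Sc :\: [set s in S | kept s && (col s == c)].
  apply/setP => s; rewrite !inE mem_enum inE /=.
  by case: (s \in S); rewrite ?andbF //=; case: (col s == c); rewrite ?andbF ?andbT.
have hO := cardsID [set o in Dr | col o == c] Oc.
have hS := cardsID [set s in S | kept s && (col s == c)] Sc.
have eO : Oc :&: [set o in Dr | col o == c] = [set o in Dr | col o == c].
  apply/setIidPr/subsetP => o; rewrite !inE => /andP[/(subsetP Dr_floating) + ->].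
  by rewrite inE => /andP[-> _].
have eS : Sc :&: [set s in S | kept s && (col s == c)] =
          [set s in S | kept s && (col s == c)].
  by apply/setIidPr/subsetP => s; rewrite !inE => /and3P[-> _ ->].
by move: hO hS; rewrite eO eS card_Dr /Oc /Sc card_col; clear; lia.
Qed.

Lemma exists_blocks : exists2 bs, perm_eq (enum items) (flatten bs) &
  {in bs, forall b, [/\ (0 < size b)%N, (size b <= L)%N
                     & forall c, \sum_(i <- b) vec c i = 0]}.
Proof.
have vb c : {in enum items, forall i, `|vec c i| <= D.+1%:Z}.
  move=> i; rewrite mem_enum inE => hi; apply: vec_bound.
  by case: i hi => //= s /andP[].
have [bs pbs bsP] := zero_sum_partition2 (vb true) (vb false) (sum_vec_items true) (sum_vec_items false).
by exists bs => // b /bsP[b1 b2 b3 b4]; split=> // -[].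
Qed.

Variable bs : seq (seq (F + F)).
Hypothesis bs_perm : perm_eq (enum items) (flatten bs).
Hypothesis bs_gt0 : {in bs, forall b, (0 < size b)%N}.
Hypothesis bs_size : {in bs, forall b, (size b <= L)%N}.
Hypothesis bs_vec : {in bs, forall b c, \sum_(i <- b) vec c i = 0}.

Lemma uniq_bs : uniq (flatten bs).
Proof. by rewrite -(perm_uniq bs_perm) enum_uniq. Qed.

Lemma mem_bs b i : b \in bs -> i \in b -> is_item i.
Proof.
move=> bb ib; have : i \in flatten bs by apply/flattenP; exists b.
by rewrite -(perm_mem bs_perm) mem_enum inE.
Qed.

Lemma item_block i : is_item i -> exists2 b, b \in bs & i \in b.
Proof.
by move=> hi; apply/flattenP; rewrite -(perm_mem bs_perm) mem_enum inE.
Qed.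

Lemma uniq_block b : b \in bs -> uniq b.
Proof.
move: uniq_bs; elim: (bs) => //= a cs IH; rewrite cat_uniq => /and3P[ua _ /IH h].
by rewrite inE => /orP[/eqP->|/h].
Qed.

Lemma block_inj b b' i : b \in bs -> b' \in bs -> i \in b -> i \in b' -> b = b'.
Proof.
move: uniq_bs; elim: (bs) => //= a cs IH; rewrite cat_uniq => /and3P[_ dis ucs].
have no c : c \in cs -> i \in c -> i \in a -> False.
  by move=> cc ic ia; case/negP: dis; apply/hasP; exists i => //; apply/flattenP; exists c.
rewrite !inE => /orP[/eqP->|bc] /orP[/eqP->|bc'] ib ib' //; last exact: IH.
  by case: (no _ bc' ib' ib).
by case: (no _ bc ib ib').
Qed.

Definition cross_block (b : seq (F + F)) : bool :=
  has (fun i => if i is inl s then cross s else false) b.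

Definition weight (b : seq (F + F)) : R := if cross_block b then 1 else 2.

(** The positions without an opening, and those of [Xset] whose opening occurs in a block of weight
    1. *)
Definition bad : {set F} :=
  Dr :|: [set x in Xset | has (fun b => cross_block b && (inr x \in b)) bs].

(** Each large facility closes in at most one block, which has at most [L] positions, and accounts
    for at most one dropped position. These [L + 1] positions face at least [M (L + 1)] elements of
    [Xset] per large facility. *)
Lemma card_bad_X : (M * #|bad :&: Xset| <= #|Xset|)%N.
Proof.
(* The block closing [s]. If there is none, the index is out of range and the block is empty. *)
pose blk s : seq (F + F) := nth [::] bs (find (fun b => inl s \in b) bs).
have blkP b s : b \in bs -> inl s \in b -> blk s = b.
  move=> bb sb; have hb : has (fun b => inl s \in b) bs by apply/hasP; exists b.
  apply: (@block_inj _ _ (inl s)) => //; first by rewrite mem_nth -?has_find.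
  exact: (@nth_find _ [::] (fun b => inl s \in b)).
have cblk s : (#|[set x : F | inr x \in blk s]| <= L)%N.
  have [hb|/negbTE hb] := boolP (has (fun b => inl s \in b) bs); last first.
    rewrite /blk nth_default ?(eq_card0 _) // => [x|]; first by rewrite !inE.
    by rewrite leqNgt -has_find hb.
  have bb : blk s \in bs by rewrite mem_nth -?has_find.
  apply: leq_trans (bs_size bb).
  rewrite -(card_imset _ (@inr_inj F F)); apply: leq_trans (card_size _).
  by apply/subset_leq_card/subsetP => _ /imsetP[x + ->]; rewrite inE.
apply: leq_trans card_lset; rewrite -mulnA leq_mul2l; apply/orP; right.
apply: (@leq_trans (#|Dr :&: Xset| + #|\bigcup_(s in lset) [set x : F | inr x \in blk s]|)).
  apply: leq_trans (leq_card_setU _ _); apply/subset_leq_card/subsetP => x.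
  case/setIP => /setUP[xD|+] xX; first by rewrite in_setU in_setI xD xX.
  rewrite inE => /andP[_ /hasP[b bb /andP[/hasP[[s|//] sb cs] xb]]].
  rewrite in_setU; apply/orP; right; apply/bigcupP; exists s.
    rewrite inE; case/and3P: (cs) => -> _ _; rewrite andbT.
    by have := mem_bs bb sb; case/andP.
  by rewrite inE (blkP b).
rewrite mulSn leq_add // mulnC -sum_nat_const.
apply: leq_trans (_ : \sum_(s in lset) #|[set x : F | inr x \in blk s]| <= _)%N.
  elim/big_ind2: _ => [|A n B m h1 h2|s _] //; first by rewrite cards0.
  by apply: leq_trans (leq_card_setU _ _) _; apply: leq_add.
by apply: leq_sum.
Qed.

Hypothesis M_le_D : (M <= D)%N.

(** For [o] in [Xset] this is the count of bad elements there. For [o] captured by a heavy facility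
    of the same colour, the class has more than [D >= M] elements, at most one of them bad. Any
    other [o] is fixed and not bad, since dropped facilities are of the first two kinds. *)
Lemma card_bad_perms o : o \in floating ->
  (M * #|[set u in G | u o \in bad]| <= #|G|)%N.
Proof.
move=> ofl.
have hit (A Cl : {set F}) : Cl =i [set x | kappa x == kappa o] -> bad :&: Cl \subset A ->
    (0 < #|Cl|)%N -> (M * #|A| <= #|Cl|)%N -> (M * #|[set u in G | u o \in bad]| <= #|G|)%N.
  move=> eCl sA Cl0 hA.
  have le1 : (#|[set u in G | u o \in bad]| * #|Cl| <= #|G| * #|A|)%N.
    rewrite (eq_card eCl); apply: leq_trans (class_perms_hit kappa A o).
    rewrite leq_mul2r; apply/orP; right; apply/subset_leq_card/subsetP => u.
    rewrite inE => /andP[uG ub]; rewrite inE uG /=; apply: (subsetP sA).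
    rewrite in_setI ub eCl inE; apply/eqP.
    exact: (elimT (class_permsP _ _) uG).
  rewrite -(leq_pmul2r Cl0) -mulnA; apply: leq_trans (_ : M * (#|G| * #|A|) <= _)%N.
    by rewrite leq_mul2l le1 orbT.
  by rewrite mulnCA leq_mul2l hA orbT.
have [oX|oX] := boolP (o \in Xset).
  apply: (hit (bad :&: Xset) Xset) => //; last exact: card_bad_X.
    move=> x; rewrite [in RHS]inE /kappa oX; case: (boolP (x \in Xset)) => // _.
    by case: ifP.
  by apply/card_gt0P; exists o.
have [hv|nhv] := boolP [&& o \in O, heavy (phi o) & col o != c1].
  have [oO hv' co] := and3P hv.
  have bO : (#|bad :&: own (phi o)| <= 1)%N.
    apply: leq_trans (card_Dr_own hv'); apply/subset_leq_card/subsetP => x.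
    case/setIP => /setUP[xD|+] xo; first by rewrite in_setI xD xo.
    rewrite inE => /andP[xX _].
    move: xX xo hv'; rewrite !inE => /and3P[_ _ /eqP->] /and3P[_ _ /eqP e].
    by rewrite /heavy -e eqxx andbF.
  have [_ _ ho] := and3P hv'.
  apply: (hit (bad :&: own (phi o)) (own (phi o))) => //; first last.
  - by apply: leq_trans (_ : M * 1 <= _)%N; [rewrite leq_mul2l bO orbT | lia].
  - by lia.
  move=> x; rewrite [in RHS]inE /kappa (negbTE oX) hv.
  have cph : (col (phi o) != c1) by case/and3P: hv'.
  rewrite inE; case: (boolP (x \in Xset)) => [|xX].
    by rewrite inE => /and3P[_ _ /eqP->]; rewrite [c1 == _]eq_sym (negbTE cph) !andbF.
  case: ifPn => [/and3P[xO hx cx]|].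
    rewrite xO /= -[RHS]/(phi x == phi o); case: eqP => //= e.
    by move: cx cph; case: (col x) (col (phi o)) (c1) => [] [] [].
  rewrite -[RHS]/false; apply: contraNF => /and3P[xO /eqP e /eqP ec].
  by rewrite xO e hv' ec cph.
rewrite (_ : [set u in G | u o \in bad] = set0) ?cards0 ?muln0 //.
apply/setP => u; rewrite in_set0 inE; apply/negP => /andP[uG].
case: (class_permP o uG) => [| |_ _ ->]; first by rewrite (negbTE oX).
  by move=> _ oO hv co; rewrite oO hv co in nhv.
rewrite in_setU inE (negbTE oX) orbF => oD.
by rewrite (Dr_heavy oD oX) in nhv.
Qed.

Definition test_solution (u : {perm F}) (b : seq (F + F)) : {set F} :=
  (S :\: closing b) :|: opening u b.

(** An inequality only: an opened facility may already be open in [S], and under [u] fewer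
    facilities may open than under the identity. *)
Lemma card_test_solution u b c : u \in G -> b \in bs ->
  (#|[set f in test_solution u b | col f == c]| <= #|[set f in S | col f == c]|)%N.
Proof.
move=> uG bb.
have := bs_vec bb c; rewrite sum_vec ?uniq_block // => /eqP; rewrite subr_eq0 => /eqP[e].
pose Sc := [set f in S | col f == c]; pose Cc := [set s in closing b | col s == c].
have := card_opening_perm b c uG; rewrite e -/Cc => h1.
have h2 := cardsID Cc Sc.
have e1 : Sc :&: Cc = Cc.
  by apply/setIidPr/subsetP => s; rewrite !inE => /andP[/andP[-> _] ->].
rewrite -/Sc -h2 e1 addnC.
apply: leq_trans (leq_add (leqnn _) h1).
apply: leq_trans (leq_card_setU _ _); apply/subset_leq_card/subsetP => s.
by rewrite !inE; case: (col s == c); rewrite ?andbF ?andbT ?orbF.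
Qed.

Lemma card_diff_test_solution u b : b \in bs -> (#|S :\: test_solution u b| <= L)%N.
Proof.
move=> bb; apply: leq_trans (bs_size bb).
apply: (@leq_trans #|[set i : F + F | i \in b]|); last by rewrite cardsE card_size.
rewrite -(card_imset _ (@inl_inj F F)).
apply/subset_leq_card/subsetP => _ /imsetP[s + ->]; rewrite !inE.
by case: (s \in S); rewrite ?andbF //= !andbT negb_or negbK => /andP[].
Qed.

Definition reassign (u : {perm F}) (b : seq (F + F)) (j : C) : F :=
  if (pos u (og j) \in b) && ((inl (sg j) \in b) || (Oj j <= Sj j)) then og j
  else if inl (sg j) \notin b then sg j
  else if inl (phi (og j)) \notin b then phi (og j)
  else cent (phi (og j)).

(** The critical case is a closed [phi (og j)]. Being an item it is not kept, so its centre is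
    attached to it and opens in the same block. *)
Lemma reassign_test_solution u b j : b \in bs -> reassign u b j \in test_solution u b.
Proof.
move=> bb; rewrite /reassign; case: ifPn => [/andP[pb _]|h].
  by rewrite !inE ogO pb orbT.
case: ifPn => [sb|_]; first by rewrite !inE sgS (negbTE sb).
case: ifPn => [pb|]; first by rewrite !inE phiS (negbTE pb).
rewrite negbK => pb; have := mem_bs bb pb; rewrite /= phiS /= => nk.
have oO := ogO j.
suff ac : attached (cent (phi (og j))) by rewrite !inE centO // /pos ac phi_cent // pb orbT.
rewrite /attached centO // phi_cent // eqxx /= !andbT.
move: nk; rewrite /kept /small /medium /cross /large.
by case: (leqP (deg _) D) => //= _; case: leqP => //= _; rewrite negb_or -leqNgt => /andP[->].
Qed.

(** The effects of opening [og j] and of closing [sg j] are separated so that each can be summed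
    over the blocks on its own. If both happen in one block, the change is [Oj j - Sj j], which the
    sum of the two terms still covers. *)
Lemma reassign_dist u b j : d (pF (reassign u b j)) (pC j) - Sj j <=
  (if pos u (og j) \in b then Num.min 0 (Oj j - Sj j) else 0) +
  (if inl (sg j) \in b then
     (if (inl (phi (og j)) \in b) && (pos u (og j) \notin b) then 3 * Oj j + Sj j
      else 2 * Oj j) else 0).
Proof.
rewrite /reassign; have O0 := d_ge0 (pF (og j)) (pC j); have S0 := d_ge0 (pF (sg j)) (pC j).
have h1 := dist_phi_og j; have h2 := dist_cent_og j.
case: (pos u (og j) \in b) => /=; case: (inl (sg j) \in b) => /=;
  rewrite ?andbF ?andbT //=.
- by rewrite /Num.min; case: ltP; lra.
- by rewrite /Num.min; case: (leP (Oj j) (Sj j)) => ? /=; case: ltP => ? /=; lra.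
- by case: ifPn => hp; [rewrite (negbTE hp)|rewrite negbK in hp; rewrite hp]; lra.
- by lra.
Qed.

Lemma weight_ge1 b : 1 <= weight b. Proof. by rewrite /weight; case: ifP => _; lra. Qed.

Lemma weight_le2 b : weight b <= 2. Proof. by rewrite /weight; case: ifP => _; lra. Qed.

(** Below, [A] is the effect of opening [og j] and [B] that of closing [sg j]. The exceptional case
    is that [sg j] and [phi (og j)] close in one block while [og j] does not open in it. Then
    [phi (og j)] is not small, since all its captures would open with it, so it is medium or
    cross. *)
Lemma client_change u j : u \in G ->
  \sum_(b <- bs) weight b * (d (pF (reassign u b j)) (pC j) - Sj j) <=
  5 * Oj j - Sj j
  + 2 * Sj j * ((og j \in floating) && (u (og j) \in bad))%:R
  + 3 * (Oj j + Sj j) * (medium (phi (og j)))%:R.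
Proof.
move=> uG; set o := og j; set s := sg j; set x := Oj j; set y := Sj j.
have x0 : 0 <= x by apply: d_ge0.
have y0 : 0 <= y by apply: d_ge0.
pose mn : R := Num.min 0 (x - y).
have mn0 : mn <= 0 by rewrite /mn ge_min lexx.
have mnxy : mn <= x - y by rewrite /mn ge_min lexx orbT.
pose h (b : seq (F + F)) : R := if (inl (phi o) \in b) && (pos u o \notin b) then 3 * x + y else 2 * x.
apply: (@le_trans _ _ (\sum_(b <- bs | pos u o \in b) weight b * mn +
                       \sum_(b <- bs | inl s \in b) weight b * h b)).
  rewrite [X in X + _]big_mkcond [X in _ + X]big_mkcond -big_split /=.
  apply: ler_sum => b _; have := reassign_dist u b j; rewrite -/x -/y -/o -/s.
  have := weight_ge1 b; move: (weight b) => w w1 hr.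
  apply: le_trans (_ : w * _ <= _); first by apply: ler_wpM2l hr; lra.
  by rewrite mulrDr /h -/mn; case: (pos u o \in b); case: (inl s \in b); rewrite ?mulr0 ?addr0.
set A := (X in X + _ <= _); set B := (X in _ + X <= _).
set bd := (o \in floating) && (u o \in bad).
have oO : o \in O := ogO j.
have A0 : A <= 0.
  by apply: sumr_le0 => b _; have := weight_ge1 b; nra.
have pos_item : ~~ bd -> is_item (pos u o).
  rewrite /bd /pos; case: (boolP (attached o)) => [ao _|nao] /=.
    by rewrite phiS keptN_attached.
  have ofl : o \in floating by rewrite inE oO.
  have [uf _] := class_perm_floating uG ofl; rewrite ofl uf /= => nb.
  by apply: contra nb => uD; rewrite in_setU uD.
have A1 : ~~ bd -> A <= x - y.
  move=> /pos_item /item_block[b bb pb]; rewrite /A (sum_block _ uniq_bs bb pb).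
  by have := weight_ge1 b; nra.
have bd1 : x - y + 4 * x <= 5 * x - y + 2 * y * bd%:R + 3 * (x + y) * (medium (phi o))%:R.
  by case: (bd); case: (medium _); rewrite ?mulr1 ?mulr0; lra.
(* The regular case: [B] is at most [4 x]. If the position is bad, the missing gain is absorbed by
   the error term [2 y]. *)
have fin B' : B <= B' -> B' <= 4 * x ->
    A + B <= 5 * x - y + 2 * y * bd%:R + 3 * (x + y) * (medium (phi o))%:R.
  move=> BB' B'x; case: (boolP bd) A1 bd1 => [_ _ _|_ /(_ isT) A1 bd1]; last by lra.
  by case: (medium _); rewrite ?mulr1 ?mulr0; lra.
have [hs|hs] := boolP (is_item (inl s)); last first.
  apply: (fin 0); last by lra.
  rewrite /B big_seq_cond big1 // => b /andP[bb sb].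
  by rewrite (mem_bs bb sb) in hs.
have [b0 b0b sb0] := item_block hs.
have eB : B = weight b0 * h b0 by rewrite /B (sum_block _ uniq_bs b0b sb0).
have [hh|hh] := boolP ((inl (phi o) \in b0) && (pos u o \notin b0)); last first.
  apply: (fin (weight b0 * (2 * x))); first by rewrite eB /h (negbTE hh).
  by have := weight_le2 b0; nra.
have eh : h b0 = 3 * x + y by rewrite /h hh.
case/andP: hh => pb0 npb0.
have nao : ~~ attached o by apply: contra npb0 => ao; rewrite /pos ao.
have ofl : o \in floating by rewrite inE oO.
have := mem_bs b0b pb0; rewrite /= phiS /= => nk.
have [me|nme] := boolP (medium (phi o)).
  (* Weight 2 and no gain: [6 x + 2 y] against [5 x - y]. The coefficient 3 of the medium term is
     what the [y] part requires. *)
  have : B <= 6 * x + 2 * y by rewrite eB eh; have := weight_le2 b0; nra.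
  by case: (bd); rewrite ?mulr1 ?mulr0; lra.
have nsm : ~~ small (phi o) by apply: contra nao => sm; rewrite /attached oO sm.
have lg : large (phi o).
  by move: nsm nme; rewrite /small /medium /large -ltnNge => ->; rewrite -ltnNge.
have cr : cross (phi o).
  by move: nk; rewrite /kept /cross lg negb_or -leqNgt.
have oX : o \in Xset.
  rewrite inE ofl lg /=; move: nao; rewrite /attached oO cr !negb_or /= => /and3P[_ _ /andP[_ nc]].
  by case/and3P: cr => _ + _; move: nc; case: (col o) (col (phi o)) (c1) => [] [] [].
have cb0 : cross_block b0 by apply/hasP; exists (inl (phi o)).
have eB' : B = 3 * x + y by rewrite eB eh /weight cb0 mul1r.
(* At a bad position the loss [3 x + y] stands alone, whence the error term [2 y]. *)
rewrite mulr0 addr0 eB'; case: (boolP bd) pos_item => [_ _|nbd /(_ isT) pi].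
  by rewrite mulr1; lra.
have [b1 b1b pb1] := item_block pi.
have uX : u o \in Xset.
  by case: (class_permP o uG) => // [nX _ _ _ _ _ _|nX _ _]; rewrite oX in nX.
have ncb1 : ~~ cross_block b1.
  apply: contra nbd => cb; rewrite /bd ofl in_setU; apply/orP; right; rewrite inE uX.
  apply/hasP; exists b1 => //; rewrite cb /=.
  by move: pb1; rewrite /pos (negbTE nao).
(* The balance that fixes the weights: [2 (x - y) + (3 x + y) = 5 x - y]. *)
have -> : A = 2 * mn by rewrite /A (sum_block _ uniq_bs b1b pb1) /weight (negbTE ncb1).
by rewrite mulr0; lra.
Qed.

Variables (eta : R) (cst : {set F} -> R).
Hypothesis eta_ge0 : 0 <= eta.
Hypothesis cst_le : forall (T : {set F}) (tau : C -> F), (forall j, tau j \in T) ->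
  cst T <= \sum_j d (pF (tau j)) (pC j).
Hypothesis local_opt : forall T : {set F},
  (forall c, #|[set f in T | col f == c]| <= #|[set f in S | col f == c]|)%N ->
  (#|S :\: T| <= L)%N -> (1 - eta) * (\sum_j Sj j) <= cst T.
Hypothesis eta_small : M%:R * (4 * #|F|%:R * eta) <= 1.

(** The blocks are nonempty and disjoint, so there are at most [2 #|F|] of them, each of weight at
    most 2, and the tests together lose at most [4 #|F| eta] times the local cost. After
    multiplication by [M] this gives one of the three copies of the local cost on the right; the
    other two come from bad positions, met with probability at most [1 / M]. *)
Lemma blocks_bound :
  M%:R * (\sum_j Sj j - 5 * \sum_j Oj j) <=
  3 * \sum_j Sj j + 3 * M%:R * \sum_j (Oj j + Sj j) * (medium (phi (og j)))%:R.
Proof.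
set SS := \sum_j Sj j; set OO := \sum_j Oj j.
set MM := \sum_j _ * (medium _)%:R.
have SS0 : 0 <= SS by apply: sumr_ge0 => j _; apply: d_ge0.
have step u : u \in G ->
    - (4 * #|F|%:R * eta * SS) <= 5 * OO - SS + 3 * MM +
    2 * \sum_j Sj j * ((og j \in floating) && (u (og j) \in bad))%:R.
  move=> uG.
  apply: (@le_trans _ _ (\sum_(b <- bs) weight b * \sum_j (d (pF (reassign u b j)) (pC j) - Sj j))).
    apply: (@le_trans _ _ (\sum_(b <- bs) (- 2 * (eta * SS)))).
      rewrite big_const_seq count_predT iter_addr addr0 -mulr_natr.
      have szb : (size bs <= 2 * #|F|)%N.
        apply: (@leq_trans (size (flatten bs))).
          rewrite size_flatten; move: bs_gt0; elim: (bs) => //= b cs IH hb.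
          rewrite -add1n leq_add //; first by apply: hb; rewrite mem_head.
          by apply: IH => c cc; apply: hb; rewrite inE cc orbT.
        rewrite -(perm_size bs_perm) -cardE; apply: leq_trans (max_card _) _.
        by rewrite card_sum mul2n addnn.
      have : (size bs)%:R <= 2 * #|F|%:R :> R by rewrite -natrM ler_nat.
      have : 0 <= eta * SS by apply: mulr_ge0.
      by nra.
    rewrite big_seq [leRHS]big_seq; apply: ler_sum => b bb.
    have h1 : (1 - eta) * SS <= \sum_j d (pF (reassign u b j)) (pC j).
      apply: le_trans (local_opt _ _) (cst_le _).
      - by move=> c; apply: card_test_solution uG bb.
      - exact: card_diff_test_solution.
      - by move=> j; apply: reassign_test_solution.
    rewrite sumrB -/SS; have := weight_ge1 b; have := weight_le2 b.
    have : 0 <= eta * SS by apply: mulr_ge0.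
    by move: (weight b) (\sum_j d _ _) h1 => w z; nra.
  under eq_bigr => b _ do rewrite mulr_sumr.
  rewrite exchange_big /=.
  apply: (le_trans (ler_sum _ (fun j _ => client_change j uG))).
  rewrite !big_split /= sumrN -mulr_sumr -/OO -/SS.
  have -> : \sum_i 3 * (Oj i + Sj i) * (medium (phi (og i)))%:R = 3 * MM.
    by rewrite /MM mulr_sumr; apply: eq_bigr => j _; rewrite mulrA.
  have -> : \sum_i 2 * Sj i * ((og i \in floating) && (u (og i) \in bad))%:R =
      2 * \sum_j Sj j * ((og j \in floating) && (u (og j) \in bad))%:R.
    by rewrite mulr_sumr; apply: eq_bigr => j _; rewrite mulrA.
  by lra.
have G0 : (0 < #|G|)%N by apply/card_gt0P; exists 1%g; apply: class_perms1.
have tot : - (4 * #|F|%:R * eta * SS) * #|G|%:R <=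
    (5 * OO - SS + 3 * MM) * #|G|%:R + 2 * \sum_j Sj j *
      (#|[set u in G | (og j \in floating) && (u (og j) \in bad)]|)%:R.
  have : \sum_(u in G) - (4 * #|F|%:R * eta * SS) <= \sum_(u in G)
      (5 * OO - SS + 3 * MM + 2 * \sum_j Sj j * ((og j \in floating) && (u (og j) \in bad))%:R).
    by apply: ler_sum => u /step.
  rewrite sumr_const [leRHS]big_split /= sumr_const -mulr_sumr exchange_big /=.
  rewrite -[X in X <= _ -> _]mulr_natr -[X in _ <= X + _ -> _]mulr_natr.
  move=> h; apply: le_trans h _.
  rewrite lerD2l ler_wpM2l //; apply: ler_sum => j _.
  rewrite -mulr_sumr -natr_sum -big_mkcondr sum1_card.
  rewrite ler_wpM2l // ler_nat subset_leq_card //; apply/subsetP => u hu.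
  by rewrite inE; exact: hu.
have badj j : M%:R * (#|[set u in G | (og j \in floating) && (u (og j) \in bad)]|)%:R
    <= #|G|%:R :> R.
  rewrite -natrM ler_nat; case: (boolP (og j \in floating)) => /= ofl.
    exact: card_bad_perms.
  rewrite (_ : [set u in _ | false] = set0) ?cards0 ?muln0 //.
  by apply/setP => u; rewrite !inE andbF.
have sumbad : M%:R * \sum_j Sj j *
      (#|[set u in G | (og j \in floating) && (u (og j) \in bad)]|)%:R <= SS * #|G|%:R.
  rewrite mulr_sumr mulr_suml; apply: ler_sum => j _.
  by rewrite mulrCA ler_wpM2l.
have gR : 0 < #|G|%:R :> R by rewrite ltr0n.
have M0 : 0 <= M%:R :> R by apply: ler0n.
have est : M%:R * (4 * #|F|%:R * eta * SS) <= SS.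
  rewrite -[leRHS]mul1r !mulrA; apply: ler_wpM2r => //.
  by move: eta_small; rewrite !mulrA.
rewrite -(ler_pM2r gR).
move: tot sumbad est; move: (\sum_j Sj j * _) => Z.
move: (4 * #|F|%:R * eta * SS) (#|G|%:R : R) gR => e g gR tot sumbad est.
have : M%:R * (- e * g) <= M%:R * ((5 * OO - SS + 3 * MM) * g + 2 * Z).
  by apply: ler_wpM2l.
have : M%:R * e * g <= SS * g by rewrite ler_wpM2r // ltW.
by lra.
Qed.

End Blocks.

Hypothesis M_le_D : (M <= D)%N.
Variables (eta : R) (cst : {set F} -> R).
Hypothesis eta_ge0 : 0 <= eta.
Hypothesis cst_le : forall (T : {set F}) (tau : C -> F), (forall j, tau j \in T) ->
  cst T <= \sum_j d (pF (tau j)) (pC j).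
Hypothesis local_opt : forall T : {set F},
  (forall c, #|[set f in T | col f == c]| <= #|[set f in S | col f == c]|)%N ->
  (#|S :\: T| <= L)%N -> (1 - eta) * (\sum_j Sj j) <= cst T.
Hypothesis eta_small : M%:R * (4 * #|F|%:R * eta) <= 1.

Lemma two_threshold_bound :
  M%:R * (\sum_j Sj j - 5 * \sum_j Oj j) <=
  3 * \sum_j Sj j + 3 * M%:R * \sum_j (Oj j + Sj j) * (medium (phi (og j)))%:R.
Proof.
have [Dr [Dr1 Dr2 Dr3 Dr4 Dr5]] := exists_dropped.
have [bs bs1 bs2] := exists_blocks Dr1 Dr2.
apply: (@blocks_bound Dr Dr1 Dr3 Dr4 Dr5 bs bs1 _ _ _ _ eta cst) => //.
- by move=> b /bs2[].
- by move=> b /bs2[].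
- by move=> b /bs2[].
Qed.

End LocalOptimum.

(** * Choice of the thresholds among many scales *)

Definition next_scale (M D : nat) : nat := (2 * M * (block_bound D.+1).+1 + 2)%N.
Definition scale (M i : nat) : nat := iter i (next_scale M) M.
Arguments scale : simpl never.
Definition swap_bound (M : nat) : nat := block_bound (scale M M).+1.

Lemma leq_block_bound K K' : (K <= K')%N -> (block_bound K <= block_bound K')%N.
Proof. by move=> le_K; rewrite /block_bound; apply: leq_mul; nia. Qed.

Lemma ltn_scale M i : (0 < M)%N -> (scale M i < scale M i.+1)%N.
Proof.
move=> M0; rewrite {2}/scale /= -/(scale M i) /next_scale /block_bound.
by move: (scale M i) => D; nia.
Qed.

Lemma leq_scale M i j : (0 < M)%N -> (i <= j)%N -> (scale M i <= scale M j)%N.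
Proof.
move=> M0; elim: j => [|j IH]; first by rewrite leqn0 => /eqP->.
rewrite leq_eqVlt => /orP[/eqP-> //|/IH h].
by apply: leq_trans h (ltnW (ltn_scale _ _)).
Qed.

(** The windows telescope to the single interval from [scale M 0] to [scale M n]. *)
Lemma sum_scale_window M n x : (0 < M)%N ->
  (\sum_(i < n) (scale M i < x <= scale M i.+1) <= 1)%N.
Proof.
move=> M0.
suff -> : (\sum_(i < n) (scale M i < x <= scale M i.+1))%N = (scale M 0 < x <= scale M n)%N.
  exact: leq_b1.
elim: n => [|n IH].
  by rewrite big_ord0; case: ltnP => //= h; rewrite leqNgt h.
rewrite big_ord_recr /= IH.
have h0 : (scale M 0 <= scale M n)%N by apply: leq_scale.
have h1 := ltn_scale n M0.
move: (scale M 0) (scale M n) (scale M n.+1) h0 h1 => a b c ab bc.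
have [xb|bx] := leqP x b; first by rewrite (leq_trans xb (ltnW bc)) addn0.
by rewrite (leq_ltn_trans ab bx).
Qed.

Section Scales.

Variables (R : realFieldType) (F C : finType) (P : Type) (d : P -> P -> R).
Variables (pF : F -> P) (pC : C -> P) (col : F -> bool).
Hypothesis d_ge0 : forall x y, 0 <= d x y.
Hypothesis d_sym : forall x y, d x y = d y x.
Hypothesis d_tri : forall x y z, d x z <= d x y + d y z.
Variables (S O : {set F}) (sg og : C -> F) (s0 : F).
Hypothesis s0S : s0 \in S.
Hypothesis sgS : forall j, sg j \in S.
Hypothesis ogO : forall j, og j \in O.
Hypothesis card_col : forall c,
  #|[set f in S | col f == c]| = #|[set f in O | col f == c]|.
Variables (M p : nat) (eta : R) (cst : {set F} -> R).
Hypothesis M_gt0 : (0 < M)%N.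
Hypothesis p_big : (swap_bound M <= p)%N.
Hypothesis eta_ge0 : 0 <= eta.
Hypothesis eta_small : M%:R * (4 * #|F|%:R * eta) <= 1.
Hypothesis cst_le : forall (T : {set F}) (tau : C -> F), (forall j, tau j \in T) ->
  cst T <= \sum_j d (pF (tau j)) (pC j).
Local Notation Sj j := (d (pF (sg j)) (pC j)).
Local Notation Oj j := (d (pF (og j)) (pC j)).
Hypothesis local_opt : forall T : {set F},
  (forall c, #|[set f in T | col f == c]| = #|[set f in S | col f == c]|) ->
  (#|S :\: T| <= p)%N -> (1 - eta) * (\sum_j Sj j) <= cst T.

(** Test solutions may be short of facilities, whereas local optimality concerns exact counts.
    Missing ones are added from [S], which has enough of each colour outside [T]. A superset of [T]
    closes no more of [S] and still admits every assignment into [T]. *)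
Lemma extend_colours (T : {set F}) :
  (forall c, #|[set f in T | col f == c]| <= #|[set f in S | col f == c]|)%N ->
  exists2 T' : {set F}, T \subset T' &
    forall c, #|[set f in T' | col f == c]| = #|[set f in S | col f == c]|.
Proof.
move=> hT.
have ext c : exists B : {set F}, [/\ B \subset [set f in S | col f == c], [disjoint B & T]
    & (#|B| + #|[set f in T | col f == c]| = #|[set f in S | col f == c]|)%N].
  pose Sc := [set f in S | col f == c]; pose Tc := [set f in T | col f == c].
  have le_n : (#|Sc| - #|Tc| <= #|Sc :\: Tc|)%N.
    by rewrite cardsD leq_sub2l // subset_leq_card // subsetIr.
  have [B BS cB] := exists_subset_card le_n.
  exists B; split.
  - by apply: subset_trans BS (subsetDl _ _).
  - rewrite disjoint_subset; apply/subsetP => f /(subsetP BS).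
    by rewrite !inE => /and3P[nT _ fc]; move: nT; rewrite fc andbT.
  - by rewrite cB subnK // hT.
have [Bt [Bt1 Bt2 Bt3]] := ext true; have [Bf [Bf1 Bf2 Bf3]] := ext false.
exists (T :|: (Bt :|: Bf)); first exact: subsetUl.
have colB c (B : {set F}) f : B \subset [set f in S | col f == c] -> f \in B -> col f = c.
  by move=> sB fB; move: (subsetP sB _ fB); rewrite inE => /andP[_ /eqP].
have key c (B B' : {set F}) : B \subset [set f in S | col f == c] ->
    B' \subset [set f in S | col f == ~~ c] -> [disjoint B & T] ->
    #|[set f in T :|: (B :|: B') | col f == c]| = (#|B| + #|[set f in T | col f == c]|)%N.
  move=> h1 h2 h3; rewrite -cardsUI.
  have -> : B :&: [set f in T | col f == c] = set0.
    apply/setP => f; rewrite !inE; apply/negP => /and3P[fB fT _].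
    by move: h3; rewrite disjoint_subset => /subsetP/(_ _ fB); rewrite !inE fT.
  rewrite cards0 addn0; apply: eq_card => f; rewrite !inE.
  have [fB|] := boolP (f \in B); first by rewrite (colB _ _ _ h1 fB) eqxx orbT.
  have [fB|] := boolP (f \in B'); last by rewrite !orbF.
  by rewrite (colB _ _ _ h2 fB); case: (c); rewrite !andbF.
by case; [rewrite (key true) | rewrite [Bt :|: Bf]setUC (key false)].
Qed.

(** The [M] windows are disjoint, so in one of them the clients whose [phi (og j)] is medium carry
    at most [1 / M] of the total of [O + S]. For this window the bound reads
    [M (S - 5 O) <= 3 S + 3 (O + S)], which rearranges to the claim. *)
Lemma local_optimum_bound :
  (M%:R - 6) * \sum_j Sj j <= (5 * M%:R + 3) * \sum_j Oj j.
Proof.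
pose phi o : F := [arg min_(s < s0 in S) d (pF o) (pF s)]%O.
have phiP o : phi o \in S /\ forall s, s \in S -> d (pF o) (pF (phi o)) <= d (pF o) (pF s).
  by rewrite /phi; case: arg_minP.
pose cent s : F := if [pick o in O | phi o == s] is Some o0
  then [arg min_(o < o0 | (o \in O) && (phi o == s)) d (pF s) (pF o)]%O else s.
have centP o : o \in O -> [/\ cent (phi o) \in O, phi (cent (phi o)) = phi o
    & d (pF (phi o)) (pF (cent (phi o))) <= d (pF (phi o)) (pF o)].
  move=> oO; rewrite /cent; case: pickP => [o0 ho0|/(_ o)]; last by rewrite /= oO eqxx.
  case: arg_minP => // o1 /andP[o1O /eqP e1] h1; split=> //.
  by apply: h1; rewrite oO eqxx.
pose ok (T T' : {set F}) := [&& T \subset T', #|[set f in T' | col f == true]| == #|[set f in S | col f == true]|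
  & #|[set f in T' | col f == false]| == #|[set f in S | col f == false]|].
(* A test solution is charged the cost of a completion with exact colour counts. *)
pose ext (T : {set F}) := odflt T [pick T' | ok T T'].
have extS (T : {set F}) : T \subset ext T.
  by rewrite /ext; case: pickP => //= T' /and3P[].
pose win i j := (scale M i < deg O phi (phi (og j)) <= scale M i.+1)%N.
pose mass i := \sum_j (Oj j + Sj j) * (win i j)%:R.
have [i [iM hi]] : exists i : nat, (i < M)%N /\ M%:R * mass i <= \sum_j (Oj j + Sj j).
  have [/existsP[i hi]|] := boolP [exists i : 'I_M, M%:R * mass i <= \sum_j (Oj j + Sj j)].
    by exists i.
  rewrite negb_exists => /forallP h; exfalso.
  have hs : \sum_(i < M) mass i <= \sum_j (Oj j + Sj j).
    rewrite exchange_big /=; apply: ler_sum => j _; rewrite -mulr_sumr -natr_sum.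
    rewrite -[leRHS]mulr1 ler_wpM2l ?addr_ge0 // -[1]/(1%:R) ler_nat.
    exact: sum_scale_window.
  have M0 : 0 < M%:R :> R by rewrite ltr0n.
  have : \sum_(i < M) (\sum_j (Oj j + Sj j)) < \sum_(i < M) (M%:R * mass i).
    apply: ltr_sum; last by move=> i _; move: (h i); rewrite -ltNge.
    by apply/hasP; exists (Ordinal M_gt0); rewrite ?mem_index_enum.
  rewrite -mulr_sumr sumr_const card_ord -[X in X < _]mulr_natl ltr_pM2l // ltNge.
  by rewrite hs.
pose lg c := #|[set o in O | (scale M i.+1 < deg O phi (phi o))%N && (col o == c)]|.
pose c1 := (lg false <= lg true)%N.
have := @two_threshold_bound R F C P d pF pC col d_ge0 d_sym d_tri S O sg og phi cent sgS ogO
  card_col (fun o => (phiP o).1) (fun o => (phiP o).2) _ _ _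
  (scale M i) (scale M i.+1) M c1 _ _ M_gt0 _ _ eta (fun T => cst (ext T)) eta_ge0 _ _ eta_small.
rewrite /medium -/(mass i) => H.
have {H} H : M%:R * (\sum_j Sj j - 5 * \sum_j Oj j) <= 3 * \sum_j Sj j + 3 * M%:R * mass i.
  apply: H.
  - by move=> o /centP[].
  - by move=> o /centP[].
  - by move=> o /centP[].
  - exact/ltnW/ltn_scale.
  - rewrite /large /c1.
    have e c : #|[set o in O | (scale M i.+1 < deg O phi (phi o))%N && (col o != c)]| = lg (~~ c).
      by apply: eq_card => o; rewrite !inE; case: (col o) c => [] [].
    by rewrite e; case: (leqP (lg false) (lg true)) => [h|/ltnW h]; exact: h.
  - by rewrite leqnn.
  - exact: (@leq_scale M 0).
  - move=> T tau hT; apply: cst_le => j; exact: (subsetP (extS T)).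
  move=> T hT hST; rewrite /ext; case: pickP => [T' /and3P[h1 /eqP h2 /eqP h3]|no] /=.
    apply: local_opt; first by case.
    apply: leq_trans p_big; apply: leq_trans (_ : #|S :\: T| <= _)%N.
      by rewrite subset_leq_card // setDS.
    apply: leq_trans hST _; apply: leq_block_bound; rewrite ltnS.
    by apply: leq_scale => //; apply: ltnW.
  have [T' sT' cT'] := extend_colours hT.
  by move: (no T'); rewrite /ok sT' !cT' !eqxx.
move: hi; rewrite big_split /=.
move: (\sum_j Sj j) (\sum_j Oj j) (mass i) H => SS OO m; lra.
Qed.

End Scales.

Local Close Scope ring_scope.

(** Running time of programs on bounded memories *)

Local Open Scope nat_scope.

(** A constant counts by its value, so that the size bounds its length in binary as well. The
    program being fixed, sizes enter the running time as constants. *)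
Fixpoint esize (e : expr) : nat :=
  match e with
  | Const n => n.+1
  | Get _ e1 => (esize e1).+1
  | Bin _ e1 e2 => (esize e1 + esize e2).+1
  end.

Definition bounded (V : nat) (m : memory) : Prop := forall a i, m a i < 2 ^ V.

Lemma esize_gt0 e : 0 < esize e. Proof. by case: e. Qed.

Lemma leq_add_exp2 a b : 0 < a -> 0 < b -> 2 ^ a + 2 ^ b <= 2 ^ (a + b).
Proof.
move=> a0 b0; rewrite expnD.
have: 2 ^ 1 <= 2 ^ a by rewrite leq_exp2l.
have: 2 ^ 1 <= 2 ^ b by rewrite leq_exp2l.
rewrite expn1; nia.
Qed.

(** No operation yields more bits than its operands have together. *)
Lemma eval_bound V m e : 0 < V -> bounded V m -> eval m e < 2 ^ (V * esize e).
Proof.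
move=> V0 bm; elim: e => [n|a e1 _|o e1 IH1 e2 IH2] /=.
- by apply: leq_trans (ltn_expl n (ltnSn 1)) _; rewrite leq_exp2l //; nia.
- by apply: leq_trans (bm _ _) _; rewrite leq_exp2l //; nia.
have s1 := esize_gt0 e1; have s2 := esize_gt0 e2.
move: (eval m e1) (eval m e2) IH1 IH2 => x y IH1 IH2.
have le_e : 2 ^ (V * esize e1 + V * esize e2) <= 2 ^ (V * (esize e1 + esize e2).+1).
  by rewrite leq_exp2l // -mulnDr leq_mul2l leqnSn orbT.
apply: leq_trans le_e.
have lx : x < 2 ^ (V * esize e1 + V * esize e2).
  by apply: leq_trans IH1 _; rewrite leq_exp2l // leq_addr.
have l1 : 1 < 2 ^ (V * esize e1 + V * esize e2).
  by rewrite -{1}(expn0 2) ltn_exp2l // addn_gt0 muln_gt0 V0 s1.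
case: o => /=.
- apply: leq_trans (leq_add_exp2 _ _); rewrite ?muln_gt0 ?V0 //.
  by rewrite -addnS leq_add // ltnW.
- by apply: leq_ltn_trans lx; apply: leq_subr.
- by rewrite expnD; case: x IH1 {lx} => [|x] IH1; rewrite ?mul0n ?muln_gt0 ?expn_gt0 // ltn_mul.
- by apply: leq_ltn_trans lx; apply: leq_div.
- by apply: leq_ltn_trans lx; apply: leq_mod.
- by apply: leq_ltn_trans l1; apply: leq_b1.
- by apply: leq_ltn_trans l1; apply: leq_b1.
Qed.

Lemma bitlen_le n k : n < 2 ^ k -> bitlen n <= k.+1.
Proof.
move=> nk; rewrite /bitlen ltnS; case: n nk => [|n] nk; first by rewrite trunc_log0.
by rewrite -(@leq_exp2l 2) //; apply: leq_trans (ltnW nk); apply: trunc_logP.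
Qed.

Definition ecost_bound (V : nat) (e : expr) : nat := esize e * (V * esize e).+1.

Lemma ecost_le V m e : 0 < V -> bounded V m -> ecost m e <= ecost_bound V e.
Proof.
move=> V0 bm; rewrite /ecost_bound.
have node e' : bitlen (eval m e') <= (V * esize e').+1.
  by apply: bitlen_le; apply: eval_bound.
elim: e => [n|a e1 IH1|o e1 IH1 e2 IH2].
- have := node (Const n); rewrite /= addn0; nia.
- have := node (Get a e1); rewrite /=; nia.
- rewrite -[ecost _ _]/(bitlen (eval m (Bin o e1 e2)) + (ecost m e1 + ecost m e2)).
  have := node (Bin o e1 e2); rewrite [esize (Bin _ _ _)]/=.
  move: (bitlen _) => w; nia.
Qed.

Fixpoint time_bound (W V : nat) (c : cmd) : nat :=
  match c with
  | Skip => 1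
  | Assign _ e1 e2 => ecost_bound V e1 + ecost_bound V e2
  | Seq c1 c2 => time_bound W V c1 + time_bound W V c2
  | If e c1 c2 => ecost_bound V e + (time_bound W V c1 + time_bound W V c2)
  | While e c1 => W * (ecost_bound V e + time_bound W V c1) + ecost_bound V e
  end.

(* [runs W V c m Q]: from [m] the command [c] halts in a memory satisfying [Q]
   with all cells below [2 ^ V], within the time allowed when each of its
   loops makes at most [W] iterations on such memories. *)
Definition runs (W V : nat) (c : cmd) (m : memory) (Q : memory -> Prop) : Prop :=
  exists t m', [/\ exec c m t m', t <= time_bound W V c, bounded V m' & Q m'].

Fixpoint writes (c : cmd) : seq nat :=
  match c with
  | Skip => [::]
  | Assign a _ _ => [:: a]
  | Seq c1 c2 => writes c1 ++ writes c2
  | If _ c1 c2 => writes c1 ++ writes c2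
  | While _ c1 => writes c1
  end.

Lemma exec_frame c m t m' a : exec c m t m' -> a \notin writes c -> m' a =1 m a.
Proof.
elim=> {c m t m'} //=.
- by move=> m b e1 e2; rewrite inE => /negbTE ab i; rewrite /update ab.
- by move=> c1 c2 m t1 m1 t2 m2 _ IH1 _ IH2; rewrite mem_cat negb_or => /andP[/IH1 h1 /IH2 h2] i; rewrite h2 h1.
- by move=> e c1 c2 m t m' _ _ IH; rewrite mem_cat negb_or => /andP[/IH].
- by move=> e c1 c2 m t m' _ _ IH; rewrite mem_cat negb_or => /andP[_ /IH].
- by move=> e c m t1 m1 t2 m2 _ _ IH1 _ IH2 na i; rewrite IH2 // IH1.
Qed.

Section Runs.

Variables W V : nat.
Hypothesis V_gt0 : 0 < V.

Lemma runs_frame c m Q : runs W V c m Q ->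
  runs W V c m (fun m' => Q m' /\ forall a, a \notin writes c -> m' a =1 m a).
Proof.
case=> t [m' [ex le_t bm Qm]]; exists t, m'; split=> //; split=> // a.
exact: exec_frame ex.
Qed.

Lemma runs_conseq c m (Q Q' : memory -> Prop) :
  (forall m', bounded V m' -> Q m' -> Q' m') -> runs W V c m Q -> runs W V c m Q'.
Proof.
by move=> QQ' [t [m' [ex le_t bm Qm]]]; exists t, m'; split=> //; apply: QQ'.
Qed.

Lemma runs_skip m (Q : memory -> Prop) : bounded V m -> Q m -> runs W V Skip m Q.
Proof. by move=> bm Qm; exists 1, m; split=> //; apply: ExecSkip. Qed.

Lemma bounded_update m a i v : bounded V m -> v < 2 ^ V -> bounded V (update m a i v).
Proof. by move=> bm hv b j; rewrite /update; case: ifP. Qed.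

Lemma runs_assign m a e1 e2 (Q : memory -> Prop) : bounded V m -> eval m e2 < 2 ^ V ->
  Q (update m a (eval m e1) (eval m e2)) -> runs W V (Assign a e1 e2) m Q.
Proof.
move=> bm he Qm; exists (ecost m e1 + ecost m e2), (update m a (eval m e1) (eval m e2)).
split=> //; first exact: ExecSet; last exact: bounded_update.
by rewrite /= leq_add // ecost_le.
Qed.

Lemma runs_seq c1 c2 m (Q1 Q : memory -> Prop) : runs W V c1 m Q1 ->
  (forall m1, bounded V m1 -> Q1 m1 -> runs W V c2 m1 Q) -> runs W V (Seq c1 c2) m Q.
Proof.
move=> [t1 [m1 [ex1 le1 bm1 Qm1]]] /(_ m1 bm1 Qm1) [t2 [m2 [ex2 le2 bm2 Qm2]]].
exists (t1 + t2), m2; split=> //; first exact: ExecSeq ex1 ex2.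
by rewrite /= leq_add.
Qed.

Lemma runs_if e c1 c2 m (Q : memory -> Prop) : bounded V m ->
  (eval m e != 0 -> runs W V c1 m Q) -> (eval m e = 0 -> runs W V c2 m Q) ->
  runs W V (If e c1 c2) m Q.
Proof.
move=> bm h1 h2; have he := ecost_le e V_gt0 bm.
have [e0|e0] := eqVneq (eval m e) 0.
  have [t [m' [ex le_t bm' Qm]]] := h2 e0.
  exists (ecost m e + t), m'; split=> //; first exact: ExecIfFalse.
  by rewrite /=; lia.
have [t [m' [ex le_t bm' Qm]]] := h1 e0.
exists (ecost m e + t), m'; split=> //; first exact: ExecIfTrue.
by rewrite /=; lia.
Qed.

(** The index of the invariant counts iterations. Proving it below [W] whenever another iteration
    starts yields termination and the time bound at once. *)
Lemma runs_while e c m (Inv : nat -> memory -> Prop) (Q : memory -> Prop) :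
  bounded V m -> Inv 0 m ->
  (forall k m1, bounded V m1 -> Inv k m1 -> eval m1 e != 0 ->
     k < W /\ runs W V c m1 (Inv k.+1)) ->
  (forall k m1, bounded V m1 -> Inv k m1 -> eval m1 e = 0 -> Q m1) ->
  runs W V (While e c) m Q.
Proof.
move=> bm I0 step fin.
suff gen k m1 : bounded V m1 -> Inv k m1 -> exists t m', [/\ exec (While e c) m1 t m',
    t <= (W - k) * (ecost_bound V e + time_bound W V c) + ecost_bound V e,
    bounded V m' & Q m'].
  have [t [m' [ex le_t bm' Qm]]] := gen 0 m bm I0.
  by exists t, m'; split=> //; move: le_t; rewrite subn0.
have [n] := ubnP (W - k); elim: n k m1 => // n IH k m1 hn bm1 Ik.
have he := ecost_le e V_gt0 bm1.
have [e0|e0] := eqVneq (eval m1 e) 0.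
  exists (ecost m1 e), m1; split=> //; first exact: ExecWhileFalse.
    by rewrite (leq_trans he) // leq_addl.
  exact: fin Ik e0.
have [kW [t1 [m2 [ex1 le1 bm2 Ik1]]]] := step k m1 bm1 Ik e0.
have [|t2 [m3 [ex2 le2 bm3 Qm]]] := IH k.+1 m2 _ bm2 Ik1; first by lia.
exists (ecost m1 e + t1 + t2), m3; split=> //; first exact: ExecWhileTrue ex1 ex2.
have -> : W - k = (W - k.+1).+1 by lia.
by rewrite mulSn; lia.
Qed.

End Runs.

Definition Var (a : nat) : expr := Get a (Const 0).
Definition SetVar (a : nat) (e : expr) : cmd := Assign a (Const 0) e.
Definition For (x : nat) (n : expr) (c : cmd) : cmd :=
  Seq (SetVar x (Const 0))
      (While (Bin OpLt (Var x) n) (Seq c (SetVar x (Bin OpAdd (Var x) (Const 1))))).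

Lemma runs_for W V x n N c m (Inv : nat -> memory -> Prop) (Q : memory -> Prop) :
  0 < V -> bounded V m -> N <= W -> N < 2 ^ V ->
  Inv 0 (update m x 0 0) ->
  (forall k m1, Inv k m1 -> eval m1 n = N) ->
  (forall k m1, bounded V m1 -> k < N -> m1 x 0 = k -> Inv k m1 ->
     runs W V c m1 (fun m2 => m2 x 0 = k /\ Inv k.+1 (update m2 x 0 k.+1))) ->
  (forall m1, bounded V m1 -> Inv N m1 -> Q m1) ->
  runs W V (For x n c) m Q.
Proof.
move=> V0 bm NW NV I0 nE step fin.
pose J k m1 := [/\ k <= N, m1 x 0 = k & Inv k m1].
have V2 : 0 < 2 ^ V by rewrite expn_gt0.
apply: (@runs_seq _ _ _ _ _ (J 0)).
  by apply: runs_assign => //=; split=> //; rewrite /update !eqxx.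
move=> m1 bm1 J0; apply: (@runs_while _ _ V0 _ _ _ J) => //.
  move=> k m2 bm2 [kN xk Ik] /=; rewrite xk (nE _ _ Ik) eqb0 negbK => lt_k.
  split; first exact: leq_trans lt_k NW.
  apply: (@runs_seq _ _ _ _ _ _ _ (step k m2 bm2 lt_k xk Ik)) => m3 bm3 [xk3 Ik3].
  apply: runs_assign => //=; rewrite xk3 addn1; first exact: leq_ltn_trans lt_k NV.
  by split=> //; rewrite /update !eqxx.
move=> k m2 bm2 [kN xk Ik] /= /eqP; rewrite xk (nE _ _ Ik) eqb0 -leqNgt => le_k.
by apply: fin => //; have <- : k = N by apply/eqP; rewrite eqn_leq kN le_k.
Qed.

(** Polynomial growth *)

Definition poly_bounded (T : Type) (sz f : T -> nat) : Prop :=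
  exists c k, forall x, f x <= c * sz x ^ k + c.

Section PolyBounded.

Variables (T : Type) (sz : T -> nat).
Local Notation pb := (poly_bounded sz).

Lemma poly_bounded_const a : pb (fun _ => a).
Proof. by exists a, 0 => x; lia. Qed.

Lemma poly_bounded_size : pb sz.
Proof. by exists 1, 1 => x; rewrite expn1; lia. Qed.

Lemma poly_bounded_add f g : pb f -> pb g -> pb (fun x => f x + g x).
Proof.
move=> [c1 [k1 h1]] [c2 [k2 h2]]; exists (2 * (c1 + c2)), (k1 + k2) => x.
have h1' := h1 x; have h2' := h2 x.
(* Size zero is separate: raising the exponent would turn [0 ^ 0 = 1] into [0]. *)
have [s0|s0] := posnP (sz x).
  move: h1' h2'; rewrite s0; case: k1 {h1} => [|k1]; case: k2 {h2} => [|k2];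
    rewrite ?expn0 ?exp0n //; lia.
have l1 : sz x ^ k1 <= sz x ^ (k1 + k2) by rewrite leq_pexp2l // leq_addr.
have l2 : sz x ^ k2 <= sz x ^ (k1 + k2) by rewrite leq_pexp2l // leq_addl.
have e1 : c1 * sz x ^ k1 <= c1 * sz x ^ (k1 + k2) by rewrite leq_mul2l l1 orbT.
have e2 : c2 * sz x ^ k2 <= c2 * sz x ^ (k1 + k2) by rewrite leq_mul2l l2 orbT.
by nia.
Qed.

Lemma poly_bounded_mul f g : pb f -> pb g -> pb (fun x => f x * g x).
Proof.
move=> [c1 [k1 h1]] [c2 [k2 h2]]; exists (4 * (c1 * c2)), (k1 + k2) => x.
apply: leq_trans (leq_mul (h1 x) (h2 x)) _; rewrite expnD.
have [s0|s0] := posnP (sz x).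
  rewrite s0; have z k : 0 ^ k <= 1 by case: k => [|k]; rewrite ?expn0 ?exp0n.
  have := z k1; have := z k2; move: (0 ^ k1) (0 ^ k2) => u v; nia.
have p1 : 0 < sz x ^ k1 by rewrite expn_gt0 s0.
have p2 : 0 < sz x ^ k2 by rewrite expn_gt0 s0.
move: (sz x ^ k1) (sz x ^ k2) p1 p2 => u v u0 v0.
have a1 : c1 * u + c1 <= 2 * c1 * u by nia.
have a2 : c2 * v + c2 <= 2 * c2 * v by nia.
apply: leq_trans (leq_mul a1 a2) _; apply: (@leq_trans (4 * (c1 * c2) * (u * v))); last by lia.
by apply: eq_leq; ring.
Qed.

Lemma poly_bounded_exp f k : pb f -> pb (fun x => f x ^ k).
Proof.
move=> hf; elim: k => [|k IH]; first exact: poly_bounded_const.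
have [c [l h]] := poly_bounded_mul hf IH.
by exists c, l => x; rewrite expnS.
Qed.

(** For a fixed program the recursion over its syntax is a fixed polynomial expression in [W] and
    [V]. *)
Lemma poly_bounded_time W V c : pb W -> pb V ->
  pb (fun x => time_bound (W x) (V x) c).
Proof.
move=> pW pV.
have ecb e : pb (fun x => ecost_bound (V x) e).
  apply: poly_bounded_mul; first exact: poly_bounded_const.
  have [c' [l h]] := poly_bounded_add (poly_bounded_mul pV (poly_bounded_const (esize e))) (poly_bounded_const 1).
  by exists c', l => x; rewrite -addn1.
elim: c => [|a e1 e2|c1 IH1 c2 IH2|e c1 IH1 c2 IH2|e c1 IH1] /=.
- exact: poly_bounded_const.
- exact: poly_bounded_add.
- exact: poly_bounded_add.
- by apply: poly_bounded_add => //; apply: poly_bounded_add.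
- apply: poly_bounded_add => //; apply: poly_bounded_mul => //.
  exact: poly_bounded_add.
Qed.

End PolyBounded.

(** The local search program *)

Local Notation aIN := 0 (only parsing).
Local Notation aSOL := 1 (only parsing).
Local Notation vN := 2 (only parsing).
Local Notation vF := 3 (only parsing).
Local Notation vD := 4 (only parsing).
Local Notation vA := 5 (only parsing).
Local Notation vT := 6 (only parsing).
Local Notation vi := 7 (only parsing).
Local Notation aCA := 8 (only parsing).
Local Notation vcode := 9 (only parsing).
Local Notation vu := 10 (only parsing).
Local Notation vv := 11 (only parsing).
Local Notation vj := 12 (only parsing).
Local Notation vf := 13 (only parsing).
Local Notation vbest := 14 (only parsing).
Local Notation vcost := 15 (only parsing).
Local Notation vcur := 16 (only parsing).
Local Notation vflag := 17 (only parsing).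
Local Notation vc := 18 (only parsing).
Local Notation vs := 19 (only parsing).
Local Notation vK := 20 (only parsing).
Local Notation vB := 21 (only parsing).

Local Notation "x [+] y" := (Bin OpAdd x y) (at level 50, left associativity).
Local Notation "x [*] y" := (Bin OpMul x y) (at level 40, left associativity).
Local Notation "x [-] y" := (Bin OpSub x y) (at level 50, left associativity).
Local Notation "x [/] y" := (Bin OpDiv x y) (at level 40, left associativity).
Local Notation "x [%] y" := (Bin OpMod x y) (at level 40, left associativity).
Local Notation "x [=] y" := (Bin OpEq x y) (at level 70).
Local Notation "x [<] y" := (Bin OpLt x y) (at level 70).
Local Notation "c1 ;; c2" := (Seq c1 c2) (at level 80, right associativity).

Definition eIn (i : nat) : expr := Get aIN (Const i).
Definition eNum (e : expr) : expr := Get aIN (Const 5 [+] e).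
Definition eDen (e : expr) : expr := Get aIN (Const 5 [+] Var vN [*] Var vN [+] e).
Definition eIdx : expr := (eIn 0 [+] Var vf) [*] Var vN [+] Var vj.
(* The distance of facility [vf] to client [vj], scaled by the common
   denominator [vD]. *)
Definition eWt : expr := eNum eIdx [*] (Var vD [/] eDen eIdx).
Definition ePow (e : expr) (n : nat) : expr := iter n (Bin OpMul e) (Const 1).

(** The value [vB] is at least every scaled distance and acts as infinity in the minimum. *)
Definition cost_cmd : cmd :=
  SetVar vcost (Const 0) ;;
  For vj (eIn 0)
    (SetVar vbest (Var vB) ;;
     For vf (Var vF)
       (If (Get aCA (Var vf))
          (If (eWt [<] Var vbest) (SetVar vbest eWt) Skip) Skip) ;;
     SetVar vcost (Var vcost [+] Var vbest)).

Definition copy_cmd (src dst : nat) : cmd :=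
  For vi (Var vF) (Assign dst (Var vi) (Get src (Var vi))).

(** Two digits of [vcode] in base [vF] name the facility to close and the one to open. An illegal
    exchange does nothing, so every code is meaningful, and fewer than [q] exchanges are encoded
    with idle ones. *)
Definition swap_cmd : cmd :=
  SetVar vu (Var vcode [%] Var vF) ;;
  SetVar vcode (Var vcode [/] Var vF) ;;
  SetVar vv (Var vcode [%] Var vF) ;;
  SetVar vcode (Var vcode [/] Var vF) ;;
  If ((Get aCA (Var vu) [=] Const 1) [*] (Get aCA (Var vv) [=] Const 0)
      [*] ((Var vu [<] eIn 1) [=] (Var vv [<] eIn 1)))
    (Assign aCA (Var vu) (Const 0) ;; Assign aCA (Var vv) (Const 1)) Skip.

Definition try_cmd (q : nat) : cmd :=
  copy_cmd aSOL aCA ;;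
  SetVar vcode (Var vc) ;;
  For vs (Const q) swap_cmd ;;
  cost_cmd ;;
  If (Var vcost [*] Var vK [<] Var vcur [*] (Var vK [-] Const 1))
    (copy_cmd aCA aSOL ;; SetVar vcur (Var vcost) ;; SetVar vflag (Const 1)) Skip.

(** The common denominator [vD] is the plain product of all denominators, whose length is still at
    most that of the input. The value [4 M F + 1] of [vK] makes the loss over all tests at most a
    fraction [1 / M] of the local cost. *)
Definition init_cmd (q M : nat) : cmd :=
  SetVar vN (eIn 0 [+] eIn 1 [+] eIn 2) ;;
  SetVar vF (eIn 1 [+] eIn 2) ;;
  SetVar vD (Const 1) ;;
  For vi (Var vN [*] Var vN)
    (SetVar vA (Var vA [+] eNum (Var vi)) ;; SetVar vD (Var vD [*] eDen (Var vi))) ;;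
  SetVar vB (Var vA [*] Var vD) ;;
  SetVar vT (ePow (Var vF) (2 * q)) ;;
  SetVar vK (Const (4 * M) [*] Var vF [+] Const 1) ;;
  For vi (eIn 3) (Assign aSOL (Var vi) (Const 1)) ;;
  For vi (eIn 4) (Assign aSOL (eIn 1 [+] Var vi) (Const 1)).

(** A pass continues through the remaining codes after an improvement. Local optimality is certified
    by the last pass, in which none occurs. *)
Definition search_cmd (q : nat) : cmd :=
  copy_cmd aSOL aCA ;;
  cost_cmd ;;
  SetVar vcur (Var vcost) ;;
  SetVar vflag (Const 1) ;;
  While (Var vflag) (SetVar vflag (Const 0) ;; For vc (Var vT) (try_cmd q)).

Definition local_search (q M : nat) : cmd := init_cmd q M ;; search_cmd q.

Lemma upd_same m a i v : update m a i v a i = v.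
Proof. by rewrite /update !eqxx. Qed.

Lemma upd_array m a i v j : update m a i v a j = if j == i then v else m a j.
Proof. by rewrite /update eqxx. Qed.

Lemma upd_diff m a i v b j : b != a -> update m a i v b j = m b j.
Proof. by rewrite /update => /negbTE->. Qed.

Lemma runs_assign_seq W V m a e1 e2 c (Q : memory -> Prop) :
  0 < V -> bounded V m -> eval m e2 < 2 ^ V ->
  (bounded V (update m a (eval m e1) (eval m e2)) ->
     runs W V c (update m a (eval m e1) (eval m e2)) Q) ->
  runs W V (Assign a e1 e2 ;; c) m Q.
Proof.
move=> V0 bm he h; apply: (@runs_seq _ _ _ _ _ (fun m1 => m1 = update m a (eval m e1) (eval m e2))).
  exact: runs_assign.
by move=> m1 bm1 ->; apply: h; apply: bounded_update.
Qed.

(** * Correctness of the program *)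

Section Spec.

Variables (q M : nat) (inp : nat -> nat).
Local Notation nC := (inp 0).
Local Notation nR := (inp 1).
Local Notation nB := (inp 2).
Local Notation kr := (inp 3).
Local Notation kb := (inp 4).
Definition nP : nat := nC + nR + nB.
Definition nF : nat := nR + nB.

Definition common_den (k : nat) : nat := \prod_(0 <= i < k) inp (5 + nP * nP + i).
Definition sum_num (k : nat) : nat := \sum_(0 <= i < k) inp (5 + i).
Definition cden : nat := common_den (nP * nP).
Definition big_wt : nat := sum_num (nP * nP) * cden.
Definition fact : nat := 4 * M * nF + 1.
Definition codes : nat := nF ^ (2 * q).

Definition wt (f j : nat) : nat :=
  inp (5 + ((nC + f) * nP + j)) * (cden %/ inp (5 + nP * nP + ((nC + f) * nP + j))).

Fixpoint best (s : nat -> nat) (j k : nat) : nat :=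
  if k is k'.+1 then
    if (s k' != 0) && (wt k' j < best s j k') then wt k' j else best s j k'
  else big_wt.

Definition costn (s : nat -> nat) : nat := \sum_(0 <= j < nC) best s j nF.

Definition swap1 (s : nat -> nat) (u v : nat) : nat -> nat :=
  if [&& s u == 1, s v == 0 & (u < nR) == (v < nR)]
  then fun f => if f == v then 1 else if f == u then 0 else s f else s.

Definition swap_step (st : nat * (nat -> nat)) : nat * (nat -> nat) :=
  (st.1 %/ nF %/ nF, swap1 st.2 (st.1 %% nF) (st.1 %/ nF %% nF)).

Definition decode (code : nat) (s : nat -> nat) : nat -> nat :=
  (iter q swap_step (code, s)).2.

(** Copying transfers only the cells of facilities, so arrays can be compared on these alone. *)
Definition agree (s s' : nat -> nat) : Prop := forall f, f < nF -> s f = s' f.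

Definition locally_optimal (s : nat -> nat) : Prop :=
  forall code, code < codes -> costn s * fact.-1 <= costn (decode code s) * fact.

Lemma agree_sym s s' : agree s s' -> agree s' s.
Proof. by move=> h f hf; rewrite h. Qed.

Lemma agree_trans s1 s2 s3 : agree s1 s2 -> agree s2 s3 -> agree s1 s3.
Proof. by move=> h1 h2 f hf; rewrite h1 // h2. Qed.

Lemma agree_best s s' j k : k <= nF -> agree s s' -> best s j k = best s' j k.
Proof. by move=> + h; elim: k => //= k IH hk; rewrite IH ?h // ltnW. Qed.

Lemma agree_costn s s' : agree s s' -> costn s = costn s'.
Proof. by move=> h; apply: eq_bigr => j _; apply: agree_best. Qed.

Lemma agree_swap1 s s' u v : u < nF -> v < nF -> agree s s' ->
  agree (swap1 s u v) (swap1 s' u v).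
Proof.
move=> hu hv h f hf; rewrite /swap1 !h //; case: ifP => _; last exact: h.
by case: ifP => // _; case: ifP => // _; rewrite h.
Qed.

Lemma agree_iter k code s s' : 0 < nF -> agree s s' ->
  (iter k swap_step (code, s)).1 = (iter k swap_step (code, s')).1 /\
  agree (iter k swap_step (code, s)).2 (iter k swap_step (code, s')).2.
Proof.
move=> F0 h; elim: k => //= k [e1 IH]; rewrite e1; split=> //.
by apply: agree_swap1 => //; rewrite ltn_mod.
Qed.

Lemma agree_decode code s s' : 0 < nF -> agree s s' ->
  agree (decode code s) (decode code s').
Proof. by move=> F0 h; apply: (agree_iter q code F0 h).2. Qed.

Lemma best_le_big s j k : best s j k <= big_wt.
Proof. by elim: k => //= k IH; case: ifP => // /andP[_ /ltnW h]; apply: leq_trans h IH. Qed.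

Definition consts (m : memory) : Prop :=
  [/\ m aIN =1 inp, m vN 0 = nP, m vF 0 = nF & [/\ m vD 0 = cden, m vT 0 = codes, m vK 0 = fact & m vB 0 = big_wt]].

Definition const_arrays : seq nat := [:: aIN; vN; vF; vD; vT; vK; vB].

Lemma consts_frame m m' : consts m ->
  (forall a, a \in const_arrays -> m' a =1 m a) -> consts m'.
Proof.
move=> [h0 h1 h2 [h3 h4 h5 h6]] fr; split; rewrite ?fr //.
by move=> i; rewrite fr.
Qed.

Lemma consts_exec c m m' : consts m -> (forall a, a \notin writes c -> m' a =1 m a) ->
  all (fun a => a \notin writes c) const_arrays -> consts m'.
Proof. by move=> cm fr /allP nc; apply: consts_frame cm _ => a /nc /fr. Qed.

Variables (W V : nat).
Hypothesis V_gt0 : 0 < V.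
Hypothesis nF_W : nF <= W.
Hypothesis nF_V : nF < 2 ^ V.
Hypothesis nC_W : nC <= W.
Hypothesis nC_V : nC < 2 ^ V.
Hypothesis q_W : q <= W.
Hypothesis q_V : q < 2 ^ V.
Hypothesis codes_W : codes <= W.
Hypothesis codes_V : codes < 2 ^ V.
Hypothesis big_V : nC * big_wt + big_wt < 2 ^ V.

Lemma eval_eWt m : consts m -> eval m eWt = wt (m vf 0) (m vj 0).
Proof. by move=> [h0 h1 h2 [h3 h4 h5 h6]] /=; rewrite !h0 !h1 h3. Qed.

Lemma run_best m s j c : bounded V m -> consts m -> agree (m aCA) s ->
  m vj 0 = j -> m vcost 0 = c -> m vbest 0 = big_wt ->
  runs W V (For vf (Var vF)
       (If (Get aCA (Var vf))
          (If (eWt [<] Var vbest) (SetVar vbest eWt) Skip) Skip)) m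
    (fun m' => [/\ consts m', agree (m' aCA) s, m' vj 0 = j, m' vcost 0 = c & m' vbest 0 = best s j nF]).
Proof.
move=> bm cm ms mj mc mb.
apply: (@runs_for _ _ _ _ nF _ _ (fun k m' => [/\ consts m', agree (m' aCA) s, m' vj 0 = j,
   m' vcost 0 = c & m' vbest 0 = best s j k])) => //.
  by move=> k m1 [[_ _ h _] _ _ _ _]; exact: h.
move=> k m1 bm1 kF m1k [c1 a1 j1 cc1 b1].
have post (m2 : memory) : consts m2 -> agree (m2 aCA) s -> m2 vj 0 = j -> m2 vcost 0 = c ->
    m2 vf 0 = k -> m2 vbest 0 = best s j k.+1 ->
    m2 vf 0 = k /\ [/\ consts (update m2 vf 0 k.+1), agree (update m2 vf 0 k.+1 aCA) s,
      update m2 vf 0 k.+1 vj 0 = j, update m2 vf 0 k.+1 vcost 0 = c &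
      update m2 vf 0 k.+1 vbest 0 = best s j k.+1].
  by move=> h1 h2 h3 h4 h5 h6; split=> //; split.
apply: runs_if => //=.
  rewrite m1k a1 // => sk; apply: runs_if => //.
    rewrite -[eval _ _]/(nat_of_bool (eval m1 eWt < m1 vbest 0)) eval_eWt // m1k j1 b1 eqb0 negbK => lt_w.
    apply: runs_assign => //; rewrite eval_eWt // m1k j1.
      by rewrite -b1 in lt_w; apply: ltn_trans lt_w (bm1 _ _).
    by apply: post => //=; rewrite upd_same sk lt_w.
  rewrite -[eval _ _]/(nat_of_bool (eval m1 eWt < m1 vbest 0)) eval_eWt // m1k j1 b1.
  move=> /eqP; rewrite eqb0 => nlt; apply: runs_skip => //; apply: post => //.
  by rewrite /= (negbTE nlt) andbF.
rewrite m1k a1 // => sk; apply: runs_skip => //; apply: post => //.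
by rewrite /= sk.
Qed.

Lemma run_cost m s : bounded V m -> consts m -> agree (m aCA) s ->
  runs W V cost_cmd m (fun m' => m' vcost 0 = costn s).
Proof.
move=> bm cm ms; apply: runs_assign_seq => //=; first by rewrite expn_gt0.
move=> bm1.
apply: (@runs_for _ _ _ _ nC _ _ (fun k m' => [/\ consts m', agree (m' aCA) s &
   m' vcost 0 = \sum_(0 <= j < k) best s j nF])) => //; last first.
- by move=> m1 _ [_ _ ->].
- move=> k m1 bm2 kC m1k [c1 a1 cost1].
  have eB : m1 vB 0 = big_wt by case: c1 => [_ _ _ []].
  apply: runs_assign_seq => //=; rewrite eB => bm3.
  apply: (@runs_seq _ _ _ _ _ (fun m' => [/\ consts m', agree (m' aCA) s, m' vj 0 = k,
     m' vcost 0 = \sum_(0 <= j < k) best s j nF & m' vbest 0 = best s k nF])).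
    by apply: run_best.
  move=> m4 bm4 [c4 a4 j4 cost4 b4].
  apply: runs_assign => //=; rewrite cost4 b4.
    apply: leq_ltn_trans big_V; rewrite leq_add ?best_le_big //.
    apply: leq_trans (_ : k * big_wt <= _); last by rewrite leq_mul2r ltnW ?orbT.
    rewrite -[k in k * _]subn0 -[_ * _]sum_nat_const_nat leq_sum // => i _.
    exact: best_le_big.
  by split=> //; split=> //; rewrite big_nat_recr //= upd_same.
- by move=> k m1 [[h _ _ _] _ _]; rewrite /= h.
- by split=> //; rewrite big_geq.
Qed.

Lemma run_copy m src dst : bounded V m -> m vF 0 = nF -> src != dst -> vF != dst -> vi != dst ->
  vi != src ->
  runs W V (copy_cmd src dst) m (fun m' => agree (m' dst) (m src)).
Proof.
move=> bm mF sd Fd id si.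
apply: (@runs_for _ _ _ _ nF _ _ (fun k m' => [/\ m' vF 0 = nF, m' src =1 m src &
   forall f, f < k -> m' dst f = m src f])) => //.
- by split=> // i; rewrite upd_diff // eq_sym.
- by move=> k m1 [].
- move=> k m1 bm1 kF m1k [h1 h2 h3]; apply: runs_assign => //=; rewrite ?upd_diff //.
  split=> //; split; rewrite ?upd_diff //.
    by move=> i; rewrite upd_diff ?upd_diff // eq_sym.
  move=> f hf; rewrite upd_diff 1?eq_sym // upd_array m1k h2.
  by case: eqP => [-> //|/eqP ne]; apply: h3; rewrite ltn_neqAle ne -ltnS.
by move=> m1 _ [_ _ h].
Qed.

Lemma run_swap m s code k : 0 < nF -> bounded V m -> consts m -> agree (m aCA) s ->
  m vcode 0 = code -> m vs 0 = k ->
  runs W V swap_cmd m (fun m' => [/\ consts m', m' vs 0 = k, m' vcode 0 = code %/ nF %/ nF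
    & agree (m' aCA) (swap1 s (code %% nF) (code %/ nF %% nF))]).
Proof.
move=> F0 bm cm ms mcode mk.
have eF : m vF 0 = nF by case: cm.
have eR : m aIN 1 = nR by case: cm => h _ _ _; rewrite h.
have code_V : code < 2 ^ V by rewrite -mcode.
set u := code %% nF; set v := code %/ nF %% nF.
have uF : u < nF by rewrite ltn_mod.
have vF_ : v < nF by rewrite ltn_mod.
do 4![apply: runs_assign_seq => //=;
  [ by rewrite /update /= mcode eF; do ?[apply: leq_ltn_trans (leq_div _ _) _
     | apply: leq_ltn_trans (leq_mod _ _) _] | move=> ?]].
set m5 := update _ _ _ _.
have b5 : bounded V m5 by [].
have c5 : consts m5 by [].
have k5 : m5 vs 0 = k by [].
have u5 : m5 vu 0 = u by rewrite /m5 /update /= mcode eF.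
have v5 : m5 vv 0 = v by rewrite /m5 /update /= mcode eF.
have code5 : m5 vcode 0 = code %/ nF %/ nF by rewrite /m5 /update /= mcode eF.
have a5 : agree (m5 aCA) s by [].
have R5 : m5 aIN 1 = nR by [].
move: m5 b5 c5 k5 u5 v5 code5 a5 R5 => m5 b5 c5 k5 u5 v5 code5 a5 R5.
have cond : (eval m5 ((Get aCA (Var vu) [=] Const 1) [*] (Get aCA (Var vv) [=] Const 0)
      [*] ((Var vu [<] eIn 1) [=] (Var vv [<] eIn 1))) != 0) =
    [&& s u == 1, s v == 0 & (u < nR) == (v < nR)].
  rewrite /= u5 v5 R5 !a5 // !muln_eq0 !negb_or !eqb0 !negbK -andbA.
  by case: (_ < _); case: (_ < _).
apply: runs_if => //.
  rewrite cond => hc; rewrite /swap1 hc.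
  apply: runs_assign_seq => //=; first by rewrite expn_gt0.
  move=> b6; apply: runs_assign => //=; first by rewrite -{1}(expn0 2) ltn_exp2l.
  split=> // f hf; rewrite (upd_diff _ _ _ _ (isT : vv != aCA)) u5 v5 !upd_array.
  by rewrite a5.
move/eqP; rewrite -[_ == 0]negbK cond => hc; rewrite /swap1 (negbTE hc).
exact: runs_skip.
Qed.

Lemma run_swaps m s code : 0 < nF -> bounded V m -> consts m -> agree (m aCA) s ->
  m vcode 0 = code ->
  runs W V (For vs (Const q) swap_cmd) m
    (fun m' => consts m' /\ agree (m' aCA) (decode code s)).
Proof.
move=> F0 bm cm ms mcode.
apply: (@runs_for _ _ _ _ q _ _ (fun k m' => [/\ consts m',
   m' vcode 0 = (iter k swap_step (code, s)).1
   & agree (m' aCA) (iter k swap_step (code, s)).2])) => //.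
  move=> k m1 bm1 kq m1k [c1 code1 a1].
  apply: runs_conseq (run_swap F0 bm1 c1 a1 code1 m1k) => m2 bm2 [c2 k2 code2 a2].
  by split.
by move=> m1 _ [].
Qed.

Lemma run_try m s code : 0 < nF -> bounded V m -> consts m -> agree (m aSOL) s ->
  m vcur 0 = costn s -> m vc 0 = code ->
  runs W V (try_cmd q) m (fun m' => [/\ consts m', m' vc 0 = code &
    if costn (decode code s) * fact < costn s * fact.-1
    then [/\ agree (m' aSOL) (decode code s), m' vcur 0 = costn (decode code s) & m' vflag 0 = 1]
    else [/\ agree (m' aSOL) s, m' vcur 0 = costn s & m' vflag 0 = m vflag 0]]).
Proof.
move=> F0 bm cm ms mcur mcode.
have eF : m vF 0 = nF by case: cm.
have h1 := runs_frame (@run_copy m aSOL aCA bm eF isT isT isT isT).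
apply: (runs_seq h1) => m1 bm1 [a1 fr1].
have c1 : consts m1 := consts_exec cm fr1 isT.
apply: runs_assign_seq => //= bm2.
have {}a1 : agree (m1 aCA) s by apply: agree_trans a1 ms.
have mc1 : m1 vc 0 = code by rewrite fr1.
have h2 := runs_frame (@run_swaps (update m1 vcode 0 (m1 vc 0)) s code F0 bm2 c1 a1 mc1).
apply: (runs_seq h2) => m3 bm3 [[c3 a3] fr3].
have h3 := runs_frame (run_cost bm3 c3 a3).
apply: (runs_seq h3) => m4 bm4 [cost4 fr4].
have c4 : consts m4 := consts_exec c3 fr4 isT.
have fr a : a \in [:: aSOL; vcur; vflag; vc] -> m4 a =1 m a.
  by rewrite !inE => /or4P[] /eqP-> i; rewrite fr4 // fr3 // upd_diff // fr1.
have a4 : agree (m4 aCA) (decode code s) by move=> f hf; rewrite fr4 // a3.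
have [_ _ F4 [_ _ K4 _]] := c4.
have cond : eval m4 (Var vcost [*] Var vK [<] Var vcur [*] (Var vK [-] Const 1)) =
    (costn (decode code s) * fact < costn s * fact.-1).
  by rewrite /= cost4 K4 fr // mcur subn1.
apply: runs_if => //; rewrite cond.
  rewrite eqb0 negbK => -> .
  apply: (runs_seq (runs_frame (@run_copy m4 aCA aSOL bm4 F4 isT isT isT isT))).
  move=> m5 bm5 [a5 fr5]; apply: runs_assign_seq => //= bm6; apply: runs_assign => //=.
    by rewrite -{1}(expn0 2) ltn_exp2l.
  have c5 : consts m5 := consts_exec c4 fr5 isT.
  split=> //; first by rewrite !upd_diff // fr5 // fr.
  split=> //; first by apply: agree_trans a4.
  by rewrite upd_diff // upd_same fr5.
move/eqP; rewrite eqb0 => /negbTE->; apply: runs_skip => //.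
by split; rewrite ?fr //; split; rewrite ?fr //; move=> f hf; rewrite fr // ms.
Qed.

Hypothesis q_gt0 : 0 < q.

Lemma codes_nF code : code < codes -> 0 < nF.
Proof. by rewrite /codes; case: nF => //; rewrite exp0n // muln_gt0. Qed.

Lemma agree_locally_optimal s s' : agree s s' -> locally_optimal s -> locally_optimal s'.
Proof.
move=> h lo code hc; rewrite -(agree_costn h).
by rewrite -(agree_costn (agree_decode code (codes_nF hc) h)); apply: lo.
Qed.

Variable Good : (nat -> nat) -> Prop.
Hypothesis Good_agree : forall s s', agree s s' -> Good s -> Good s'.
Hypothesis Good_swap : forall s u v, u < nF -> v < nF -> Good s -> Good (swap1 s u v).

Lemma Good_decode code s : 0 < nF -> Good s -> Good (decode code s).
Proof.
move=> F0 gs; rewrite /decode; elim: (q) => //= k IH.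
by apply: Good_swap; rewrite ?ltn_mod.
Qed.

(** Before any improvement all codes are tested against the same solution, which is then locally
    optimal if the pass ends so. After one the cost never rises again, so the drop by the factor
    persists to the end. *)
Lemma run_pass m : bounded V m -> consts m -> Good (m aSOL) -> m vcur 0 = costn (m aSOL) ->
  runs W V (SetVar vflag (Const 0) ;; For vc (Var vT) (try_cmd q)) m
  (fun m' => [/\ consts m', Good (m' aSOL), m' vcur 0 = costn (m' aSOL) &
    (m' vflag 0 = 0 /\ locally_optimal (m' aSOL)) \/
    (m' vflag 0 = 1 /\ m' vcur 0 * fact < m vcur 0 * fact.-1)]).
Proof.
move=> bm cm gm mcur; set s0 := m aSOL; set c0 := m vcur 0.
apply: runs_assign_seq => //=; first by rewrite expn_gt0.
move=> bm1.
apply: (@runs_for _ _ _ _ codes _ _ (fun k m' => [/\ consts m', Good (m' aSOL),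
    m' vcur 0 = costn (m' aSOL) &
    [/\ m' vflag 0 = 0, agree (m' aSOL) s0 &
      forall code, code < k -> costn s0 * fact.-1 <= costn (decode code s0) * fact] \/
    (m' vflag 0 = 1 /\ m' vcur 0 * fact < c0 * fact.-1)])) => //.
- by split=> //; left.
- by move=> k m1 [[_ _ _ [_ h _ _]] _ _ _]; exact: h.
- move=> k m1 bm2 kT m1k [c1 g1 cur1 st1].
  have F0 := codes_nF kT.
  have refl1 : agree (m1 aSOL) (m1 aSOL) by [].
  apply: runs_conseq (run_try F0 bm2 c1 refl1 cur1 m1k) => m2 bm3 [c2 k2].
  case: ifP => [lt_c [a2 cur2 f2]|ge_c [a2 cur2 f2]]; split=> //.
    split=> //; rewrite ?upd_diff //.
    + apply: Good_agree (Good_decode k F0 g1) => f hf; rewrite upd_diff // a2 //.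
    + by rewrite cur2; apply: agree_costn => f hf; rewrite upd_diff // a2.
    right; split=> //; rewrite cur2; case: st1 => [[_ a1 _]|[_ h1]].
      by move: lt_c; rewrite -cur1 cur1 (agree_costn a1) /c0 mcur.
    rewrite cur1 in h1; apply: leq_ltn_trans h1; rewrite leq_mul2r; apply/orP; right.
    have : costn (m1 aSOL) * fact.-1 <= costn (m1 aSOL) * fact by rewrite leq_mul2l leq_pred orbT.
    move/(leq_trans lt_c); rewrite ltn_mul2r => /andP[_]; exact: ltnW.
  split=> //; rewrite ?upd_diff //.
  + by apply: Good_agree g1 => f hf; rewrite upd_diff // a2.
  + by rewrite cur2; apply: agree_costn => f hf; rewrite upd_diff // a2.
  rewrite cur2 f2; case: st1 => [[fl a1 chk]|[fl h1]]; last by right; rewrite -cur1.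
  left; split=> //; first by move=> f hf; rewrite upd_diff // a2 // a1.
  move=> code; rewrite ltnS leq_eqVlt => /orP[/eqP->|/chk //].
  move/negbT: ge_c; rewrite -leqNgt (agree_costn a1).
  by rewrite (agree_costn (agree_decode k F0 a1)).
move=> m1 _ [c1 g1 cur1 st1]; split=> //; case: st1 => [[fl a1 chk]|st1]; last by right.
left; split=> //; apply: agree_locally_optimal (agree_sym a1) _.
exact: chk.
Qed.

(** By the inequality of Bernoulli, [n] factors [1 + 1/n] gain at least 2, so [n E] of them gain
    [2 ^ E]. *)
Lemma exp_pred_gap n E k : 0 < n -> n * E <= k -> 2 ^ E * n ^ k <= n.+1 ^ k.
Proof.
move=> n0 hk.
have bern l : n ^ l * (n + l) <= n * n.+1 ^ l.
  elim: l => [|l IH]; first by rewrite !expn0 addn0 mul1n muln1.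
  rewrite !expnS; apply: (@leq_trans (n.+1 * (n ^ l * (n + l)))); last by nia.
  by move: (n ^ l) => x; nia.
have wk a b l : a <= b -> a ^ l <= b ^ l by case: l => // l h; rewrite leq_exp2r.
have two : 2 * n ^ n <= n.+1 ^ n.
  by have := bern n; rewrite addnn -mul2n mulnA mulnC leq_pmul2l // mulnC.
rewrite -(subnKC hk) !expnD; rewrite mulnA leq_mul //; last exact: wk.
by rewrite !expnM -expnMn; apply: wk.
Qed.

Variable E : nat.
Hypothesis cost_E : nC * big_wt < 2 ^ E.
Hypothesis passes_W : 4 * M * nF * E + 2 <= W.

Lemma costn_lt s : costn s < 2 ^ E.
Proof.
apply: leq_ltn_trans cost_E; rewrite -[nC in nC * _]subn0 -[_ * _]sum_nat_const_nat.
by apply: leq_sum => j _; apply: best_le_big.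
Qed.

(** After [k] improving passes the cost has dropped by the [k]-th power of the factor. It may reach
    zero, but before the last of these passes it was a positive integer. The last clause of the
    invariant records this with exponent [k - 1], and since the initial cost is below [2 ^ E] it
    limits the number of passes. *)
Lemma run_search m : bounded V m -> consts m -> Good (m aSOL) ->
  runs W V (search_cmd q) m (fun m' => Good (m' aSOL) /\ locally_optimal (m' aSOL)).
Proof.
move=> bm cm gm.
have eF : m vF 0 = nF by case: cm.
apply: (runs_seq (runs_frame (@run_copy m aSOL aCA bm eF isT isT isT isT))) => m1 bm1 [a1 fr1].
have c1 : consts m1 := consts_exec cm fr1 isT.
apply: (runs_seq (runs_frame (run_cost bm1 c1 a1))) => m2 bm2 [cost2 fr2].
have c2 : consts m2 := consts_exec c1 fr2 isT.
have s2 : m2 aSOL =1 m aSOL by move=> i; rewrite fr2 // fr1.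
apply: runs_assign_seq => //= bm3; apply: runs_assign_seq => //=.
  by rewrite -{1}(expn0 2) ltn_exp2l.
move=> bm4; set C0 := costn (m aSOL) in cost2.
apply: (@runs_while _ _ V_gt0 _ _ _ (fun k m' => [/\ consts m', Good (m' aSOL),
  m' vcur 0 = costn (m' aSOL) & (m' vflag 0 = 0 /\ locally_optimal (m' aSOL)) \/
  [/\ m' vflag 0 = 1, m' vcur 0 * fact ^ k <= C0 * fact.-1 ^ k &
      0 < k -> fact ^ k.-1 <= C0 * fact.-1 ^ k.-1]])) => //.
- split=> //; first by apply: Good_agree gm => f hf; rewrite !upd_diff // s2.
    rewrite upd_diff // upd_same cost2; apply: agree_costn => f hf.
    by rewrite !upd_diff // s2.
  by right; split=> //; rewrite upd_diff // upd_same cost2 !expn0.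
- move=> k m5 bm5 [c5 g5 cur5 [[f5 _]|[f5 h5 h5']]] /=; first by rewrite f5.
  move=> _; split.
    apply: leq_trans passes_W; rewrite addn2 ltnS.
    case: k h5' {h5} => // k /(_ isT); rewrite /= ltnS => h5'.
    rewrite leqNgt; apply/negP => lt_k; move: h5'; apply/negP; rewrite -ltnNge.
    have ef : fact.-1 = 4 * M * nF by rewrite /fact addn1.
    have [z|pz] := posnP fact.-1.
      rewrite z exp0n ?muln0 ?expn_gt0 /fact ?addn1 //; exact: leq_ltn_trans lt_k.
    have e1 : fact = fact.-1.+1 by rewrite /fact addn1.
    rewrite {2}e1; apply: leq_trans (@exp_pred_gap _ E _ pz _); last by rewrite ef ltnW.
    by rewrite ltn_pmul2r ?expn_gt0 ?pz // costn_lt.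
  apply: runs_conseq (run_pass bm5 c5 g5 cur5) => m6 bm6 [c6 g6 cur6 st6].
  split=> //; case: st6 => [|[f6 lt6]]; [by left | right; split=> //].
    rewrite !expnS mulnA; apply: (@leq_trans (m5 vcur 0 * fact.-1 * fact ^ k)).
      by rewrite leq_mul2r ltnW ?orbT.
    by rewrite mulnAC [C0 * _]mulnCA mulnC leq_mul2l h5 orbT.
  move=> _ /=; apply: leq_trans h5; rewrite leq_pmull //.
  by case: (m5 vcur 0) lt6; rewrite ?mul0n.
by move=> k m5 _ [_ g5 _ [[_ lo]|[/= -> //]]].
Qed.

Hypothesis nP_V : nP < 2 ^ V.
Hypothesis nPP_W : nP * nP <= W.
Hypothesis nPP_V : nP * nP < 2 ^ V.
Hypothesis sum_V : forall k, k <= nP * nP -> sum_num k < 2 ^ V.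
Hypothesis den_V : forall k, k <= nP * nP -> common_den k < 2 ^ V.
Hypothesis kr_W : kr <= W.
Hypothesis kr_V : kr < 2 ^ V.
Hypothesis kb_W : kb <= W.
Hypothesis kb_V : kb < 2 ^ V.
Hypothesis fact_V : fact < 2 ^ V.

Definition first_solution (f : nat) : nat := (f < kr) || (nR <= f < nR + kb).

Lemma eval_ePow m e n : eval m (ePow e n) = eval m e ^ n.
Proof. by rewrite /ePow; elim: n => //= n ->; rewrite expnS. Qed.

Lemma run_init m : bounded V m -> m aIN =1 inp -> (forall a i, a != aIN -> m a i = 0) ->
  runs W V (init_cmd q M) m (fun m' => consts m' /\ agree (m' aSOL) first_solution).
Proof.
move=> bm m0 mz; have V2 : 1 < 2 ^ V by rewrite -{1}(expn0 2) ltn_exp2l.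
apply: runs_assign_seq => //=; rewrite !m0 -/nP // => bm1.
apply: runs_assign_seq => //=; rewrite !upd_diff // !m0 -/nF // => bm2.
apply: runs_assign_seq => //= bm3; set m3 := update _ _ _ _.
have b3 : bounded V m3 := bm3.
have h1 : m3 aIN =1 inp by move=> i; rewrite /m3 !upd_diff.
have A0 : m3 vA 0 = 0 by rewrite /m3 !upd_diff // mz.
have S0 i : m3 aSOL i = 0 by rewrite /m3 !upd_diff // mz.
have N3 : m3 vN 0 = nP by [].
have F3 : m3 vF 0 = nF by [].
have D3 : m3 vD 0 = 1 by [].
move: m3 b3 h1 A0 S0 N3 F3 D3 => m3 b3 h1 A0 S0 N3 F3 D3.
apply: (@runs_seq _ _ _ _ _ (fun m' => [/\ m' aIN =1 inp, m' vN 0 = nP, m' vF 0 = nF,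
   (forall i, m' aSOL i = 0) & m' vA 0 = sum_num (nP * nP) /\ m' vD 0 = cden])).
  apply: (@runs_for _ _ _ _ (nP * nP) _ _ (fun k m' => [/\ m' aIN =1 inp, m' vN 0 = nP,
    m' vF 0 = nF, (forall i, m' aSOL i = 0) & m' vA 0 = sum_num k /\ m' vD 0 = common_den k])) => //.
  - split=> //; split; rewrite ?upd_diff //.
      by rewrite A0 /sum_num big_geq.
    by rewrite D3 /common_den big_geq.
  - by move=> k m4 [_ e _ _ _] /=; rewrite e.
  move=> k m4 bm4 kN m4k [i4 N4 F4 S4 [A4 D4]].
  have eA : m4 vA 0 + m4 aIN (5 + m4 vi 0) = sum_num k.+1.
    by rewrite m4k i4 A4 /sum_num big_nat_recr.
  apply: runs_assign_seq => //=; rewrite eA; first exact: sum_V.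
  move=> bm5; have eD : m4 vD 0 * m4 aIN (5 + m4 vN 0 * m4 vN 0 + m4 vi 0) = common_den k.+1.
    by rewrite m4k i4 D4 N4 /common_den big_nat_recr.
  apply: runs_assign => //=; rewrite !upd_diff // eD; first exact: den_V.
move=> m4 bm4 [i4 N4 F4 S4 [A4 D4]].
apply: runs_assign_seq => //=; rewrite A4 D4 -/big_wt.
  by apply: leq_ltn_trans big_V; apply: leq_addl.
move=> bm5; apply: runs_assign_seq => //; rewrite eval_ePow /= upd_diff // F4 -/codes //.
move=> bm6; apply: runs_assign_seq => //=; rewrite !upd_diff // F4 -/fact //.
move=> bm7; set m7 := update _ _ _ _.
have b7 : bounded V m7 := bm7.
have c7 : consts m7 by split=> //; split=> //; rewrite /m7 !upd_diff.
have S7 i : m7 aSOL i = 0 by rewrite /m7 !upd_diff.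
move: m7 b7 c7 S7 => m7 b7 c7 S7.
apply: (@runs_seq _ _ _ _ _ (fun m' => consts m' /\ forall i, m' aSOL i = (i < kr))).
  apply: (@runs_for _ _ _ _ kr _ _ (fun k m' => consts m' /\ forall i, m' aSOL i = (i < k))) => //.
    by move=> k m8 [[e _ _ _] _] /=; rewrite e.
  move=> k m8 bm8 hk m8k [c8 S8]; apply: runs_assign => //=; rewrite m8k.
  split=> //; split=> // i; rewrite upd_diff // upd_array S8 [i < k.+1]ltnS [i <= k]leq_eqVlt.
  by case: eqP.
move=> m8 bm8 [c8 S8].
apply: (@runs_for _ _ _ _ kb _ _ (fun k m' => consts m' /\ forall i, m' aSOL i =
    ((i < kr) || (nR <= i < nR + k)))) => //.
- split=> // i; rewrite upd_diff // S8 addn0.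
  by rewrite [nR <= i]leqNgt andNb orbF.
- by move=> k m9 [[e _ _ _] _] /=; rewrite e.
- move=> k m9 bm9 hk m9k [c9 S9]; apply: runs_assign => //=; rewrite m9k.
  have -> : m9 aIN 1 = nR by case: c9 => e _ _ _; rewrite e.
  split=> //; split=> // i; rewrite upd_diff // upd_array S9.
  case: eqP => [->|/eqP ne]; first by rewrite leq_addr addnS ltnS leqnn orbT.
  by rewrite addnS ltnS [i <= _]leq_eqVlt (negbTE ne).
by move=> m9 _ [c9 S9]; split=> // f _; rewrite S9.
Qed.

Lemma run_local_search m : bounded V m -> m aIN =1 inp -> (forall a i, a != aIN -> m a i = 0) ->
  Good first_solution ->
  runs W V (local_search q M) m (fun m' => Good (m' aSOL) /\ locally_optimal (m' aSOL)).
Proof.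
move=> bm m0 mz g0; apply: (runs_seq (run_init bm m0 mz)) => m1 bm1 [c1 a1].
by apply: run_search => //; apply: Good_agree (agree_sym a1) g0.
Qed.

End Spec.

(** The program on encoded instances *)

Lemma nth_allpairs (A B T : Type) (f : A -> B -> T) (x0 : T) (a0 : A) (b0 : B)
    (s : seq A) (t : seq B) (i j : nat) : i < size s -> j < size t ->
  nth x0 [seq f x y | x <- s, y <- t] (i * size t + j) = f (nth a0 s i) (nth b0 t j).
Proof.
elim: s i => // a s IH [|i] /= hi hj; rewrite nth_cat size_map.
  by rewrite mul0n add0n hj (nth_map b0).
by rewrite mulSn -addnA ltnNge leq_addr /= addKn IH.
Qed.

Lemma ltn_bitlen x : x < 2 ^ bitlen x.
Proof. by rewrite /bitlen; apply: trunc_log_ltn. Qed.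

Lemma sum_bitlen_window (w : seq nat) (a k : nat) : a + k <= size w ->
  \sum_(0 <= i < k) bitlen (nth 0 w (a + i)) <= input_size w.
Proof.
move=> hk; rewrite /input_size -{2}(cat_take_drop a w) -(cat_take_drop k (drop a w)) !big_cat /=.
rewrite [X in _ <= _ + (X + _)](big_nth 0) size_takel; last by rewrite size_drop; lia.
rewrite [X in _ <= _ + (X + _)](_ : _ = \sum_(0 <= i < k) bitlen (nth 0 w (a + i))).
  by rewrite addnCA leq_addr.
by apply: eq_big_nat => i /andP[_ ik]; rewrite nth_take // nth_drop.
Qed.

Section Encoded.

Variable I : instance.

Local Notation w := (encode I).
Local Notation n := (input_size w).
Local Notation N := (nC I + nR I + nB I).
Definition cell (i : nat) : nat := nth 0 w i.

Lemma size_encode : size w = 5 + N * N + N * N.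
Proof. by rewrite /encode /= size_cat !size_allpairs !size_enum_ord; lia. Qed.

Lemma nP_cell : nP cell = N. Proof. by []. Qed.

Lemma nF_cell : nF cell = nR I + nB I. Proof. by []. Qed.

Lemma size_le_input : size w <= n.
Proof.
rewrite /input_size -sum1_size; apply: leq_sum => x _; by rewrite /bitlen.
Qed.

Lemma NN_le : N * N <= n.
Proof. by apply: leq_trans size_le_input; rewrite size_encode; lia. Qed.

Lemma N_le : N <= n.
Proof. by apply: leq_trans NN_le; case: N => // k; rewrite leq_pmulr. Qed.

Lemma cell_lt i : cell i < 2 ^ n.
Proof.
rewrite /cell; have [hi|hi] := ltnP i (size w); last by rewrite nth_default // expn_gt0.
apply: leq_trans (ltn_bitlen _) _; rewrite leq_exp2l //.
have := @sum_bitlen_window w i 1; rewrite addn1 => /(_ hi).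
by rewrite big_nat1 addn0.
Qed.

(** The length of a product is at most the sum of the lengths of its factors, all of which are input
    cells. *)
Lemma common_den_le k : k <= N * N -> common_den cell k <= 2 ^ n.
Proof.
move=> hk; apply: (@leq_trans (2 ^ \sum_(0 <= i < k) bitlen (cell (5 + N * N + i)))).
  rewrite /common_den nP_cell; elim: k {hk} => [|k IH]; first by rewrite !big_geq.
  by rewrite !big_nat_recr //= expnD leq_mul // ltnW // ltn_bitlen.
by rewrite leq_exp2l //; apply: sum_bitlen_window; rewrite size_encode leq_add2l.
Qed.

Lemma sum_num_le k : k <= N * N -> sum_num cell k <= 2 ^ (2 * n).
Proof.
move=> hk; apply: (@leq_trans (k * 2 ^ n)).
  rewrite /sum_num -{2}[k]subn0 -sum_nat_const_nat; apply: leq_sum => i _.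
  exact/ltnW/cell_lt.
rewrite mul2n -addnn expnD leq_mul2r; apply/orP; right.
apply: leq_trans hk _; apply: leq_trans NN_le _; exact/ltnW/ltn_expl.
Qed.

Lemma big_wt_le : big_wt cell <= 2 ^ (3 * n).
Proof.
rewrite /big_wt /cden nP_cell (_ : 2 ^ (3 * n) = 2 ^ (2 * n) * 2 ^ n); last first.
  by rewrite -expnD; congr (2 ^ _); lia.
by apply: leq_mul; [apply: sum_num_le | apply: common_den_le].
Qed.

Lemma nC_big_wt : nC I * big_wt cell + big_wt cell <= 2 ^ (4 * n).
Proof.
rewrite (_ : 2 ^ (4 * n) = 2 ^ n * 2 ^ (3 * n)); last first.
  by rewrite -expnD; congr (2 ^ _); lia.
rewrite -mulSnr; apply: leq_mul big_wt_le.
by apply: leq_trans (ltn_expl n _) => //; apply: leq_trans N_le; lia.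
Qed.

Lemma nth_num (x y : 'I_N) : cell (5 + (x * N + y)) = absz (numq (dist I x y)).
Proof.
rewrite /cell /encode nth_cat ltnNge leq_addr /= addKn nth_cat size_allpairs !size_enum_ord.
rewrite ifT; last by have := ltn_ord x; have := ltn_ord y; nia.
have := @nth_allpairs _ _ _ (fun x y => absz (numq (dist I x y))) 0 x y (enum 'I_N) (enum 'I_N) x y.
by rewrite !size_enum_ord !nth_ord_enum => ->.
Qed.

Lemma nth_den (x y : 'I_N) : cell (5 + N * N + (x * N + y)) = absz (denq (dist I x y)).
Proof.
rewrite /cell /encode -[5 + N * N + _]addnA nth_cat ltnNge leq_addr /= addKn nth_cat size_allpairs !size_enum_ord.
rewrite ltnNge leq_addr /= addKn.
have := @nth_allpairs _ _ _ (fun x y => absz (denq (dist I x y))) 0 x y (enum 'I_N) (enum 'I_N) x y.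
by rewrite !size_enum_ord !nth_ord_enum => ->.
Qed.

(** * Facilities of both colours as one type *)

Local Notation Fac := ('I_(nR I) + 'I_(nB I))%type.

Definition fac_index (f : Fac) : nat :=
  match f with inl i => i | inr i => nR I + i end.
Definition fac_point (f : Fac) : 'I_N :=
  match f with inl i => red i | inr i => blue i end.
Definition is_red (f : Fac) : bool := if f is inl _ then true else false.

Lemma fac_index_lt f : fac_index f < nF cell.
Proof. by case: f => i /=; rewrite nF_cell ?ltn_add2l // (leq_trans (ltn_ord i)) // leq_addr. Qed.

Lemma fac_index_red f : (fac_index f < nR I) = is_red f.
Proof. by case: f => i /=; rewrite ?ltn_ord // ltnNge leq_addr. Qed.

Lemma fac_index_inj : injective fac_index.
Proof.
move=> [i|i] [j|j] /=; try by move=> e; congr (_ _); apply: val_inj => //=; lia.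
- by have := ltn_ord i => + e; rewrite e ltnNge leq_addr.
- by have := ltn_ord j => + e; rewrite -e ltnNge leq_addr.
Qed.

Lemma fac_index_surj x : x < nF cell -> exists f, fac_index f = x.
Proof.
rewrite nF_cell => hx; have [xR|xR] := ltnP x (nR I); first by exists (inl (Ordinal xR)).
have hx' : x - nR I < nB I by lia.
by exists (inr (Ordinal hx')); rewrite /= subnKC.
Qed.

Lemma val_fac_point f : fac_point f = nC I + fac_index f :> nat.
Proof. by case: f => i //=; rewrite addnA. Qed.

Definition selected (s : nat -> nat) : {set Fac} := [set f | s (fac_index f) == 1].

Definition quota (c : bool) : nat := if c then kr I else kb I.

Definition balanced (A : {set Fac}) : Prop :=
  forall c, #|[set f in A | is_red f == c]| = quota c.

(** Values at most 1 reconcile the test for nonzero in the program with the test for 1 in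
    [output]. *)
Definition good (s : nat -> nat) : Prop :=
  (forall f, s (fac_index f) <= 1) /\ balanced (selected s).

Lemma good_agree s s' : agree cell s s' -> good s -> good s'.
Proof.
move=> h [s1 sb]; have e f : s (fac_index f) = s' (fac_index f).
  by apply: h; apply: fac_index_lt.
split=> [f|c]; first by rewrite -e.
by rewrite -sb; apply: eq_card => f; rewrite !inE e.
Qed.

Lemma selected_swap s u v : s (fac_index u) = 1 -> s (fac_index v) = 0 ->
  is_red u = is_red v ->
  selected (swap1 cell s (fac_index u) (fac_index v)) = v |: (selected s :\ u).
Proof.
move=> su sv uv; apply/setP => f; rewrite !inE /swap1 su sv !eqxx.
rewrite [cell 1]/(nR I) !fac_index_red uv eqxx /= !(inj_eq fac_index_inj).
by case: (f == v) => //; case: (f == u).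
Qed.

Lemma good_swap s u v : u < nF cell -> v < nF cell -> good s -> good (swap1 cell s u v).
Proof.
move=> /fac_index_surj[a <-] /fac_index_surj[b <-] [s1 sb].
rewrite /good; have [/and3P[/eqP sa /eqP sb0]|no] := boolP [&& s (fac_index a) == 1,
    s (fac_index b) == 0 & (fac_index a < cell 1) == (fac_index b < cell 1)]; last first.
  by rewrite /swap1 (negbTE no).
rewrite [cell 1]/(nR I) !fac_index_red => /eqP ab; rewrite selected_swap //; split.
  by move=> f; rewrite /swap1; case: ifP => // _; case: ifP => // _; case: ifP.
have bs : b \notin selected s by rewrite inE sb0.
have as_ : a \in selected s by rewrite inE sa.
move=> c; rewrite -sb; case: (eqVneq (is_red b) c) => [bc|bc].
  have -> : [set f in b |: (selected s :\ a) | is_red f == c] =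
            b |: ([set f in selected s | is_red f == c] :\ a).
    apply/setP => f; rewrite !inE; case: eqP => [->|] /=; first by rewrite bc eqxx.
    by rewrite andbA.
  rewrite cardsU1 !inE (_ : (s (fac_index b) == 1) = false) ?sb0 // andbF /=.
  by rewrite [RHS](cardsD1 a) !inE sa ab bc !eqxx.
apply: eq_card => f; rewrite !inE; case: (eqVneq f b) => [->|_] /=.
  by rewrite (negbTE bc) !andbF.
case: (eqVneq f a) => [->|] //=; by rewrite ab (negbTE bc) !andbF.
Qed.

Lemma balanced_subset (A B : {set Fac}) : balanced A -> balanced B -> A \subset B -> A = B.
Proof.
move=> bA bB AB; apply/setP => f; apply/idP/idP; first exact: (subsetP AB).
have /eqP e : [set g in A | is_red g == is_red f] == [set g in B | is_red g == is_red f].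
  rewrite eqEcard bA bB leqnn andbT; apply/subsetP => g; rewrite !inE => /andP[/(subsetP AB)-> ->].
  by [].
move=> fB; have: f \in [set g in B | is_red g == is_red f] by rewrite inE fB eqxx.
by rewrite -e inE => /andP[].
Qed.

(** A selected facility outside [T] is exchanged for an unselected one in [T] of the same colour,
    which exists because both sets meet the same quota. The exchange made at the start occupies the
    two lowest digits of the code. *)
Lemma swaps_reach k s (T : {set Fac}) : 0 < nF cell ->
  good s -> balanced T -> #|selected s :\: T| <= k ->
  exists2 code, code < nF cell ^ (2 * k) &
    selected (iter k (swap_step cell) (code, s)).2 = T.
Proof.
move=> F0; elim: k s => [|k IH] s gs bT.
  rewrite leqn0 cards_eq0 setD_eq0 => sT; exists 0; first by rewrite muln0 expn0.
  by rewrite /=; apply: balanced_subset => //; case: gs.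
move=> hk.
have [u [v [uF vF hk1]]] : exists u v, [/\ u < nF cell, v < nF cell &
    #|selected (swap1 cell s u v) :\: T| <= k].
  have [sT|] := boolP (selected s \subset T).
    (* An idle exchange: [s 0] cannot be both 1 and 0. *)
    exists 0, 0; split=> //; rewrite /swap1 (_ : [&& _, _ & _] = false).
      by move: sT; rewrite -setD_eq0 => /eqP->; rewrite cards0.
    by case: (s 0) => [|[|]].
  case/subsetPn => a aS aT.
  have [b] : exists b, b \in [set f in T | is_red f == is_red a] :\: selected s.
    apply/set0Pn; apply/negP; rewrite setD_eq0 => sub.
    have ba : balanced (selected s) by case: gs.
    have /eqP e : [set f in T | is_red f == is_red a] == [set f in selected s | is_red f == is_red a].
      rewrite eqEcard bT ba leqnn andbT; apply/subsetP => f hf.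
      by rewrite inE (subsetP sub _ hf); move: hf; rewrite inE => /andP[].
    have: a \in [set f in selected s | is_red f == is_red a] by rewrite inE aS eqxx.
    by rewrite -e inE (negbTE aT).
  rewrite !inE => /and3P[nb bT' /eqP ab].
  exists (fac_index a), (fac_index b); split; try exact: fac_index_lt.
  have sa : s (fac_index a) = 1 by move: aS; rewrite inE => /eqP.
  have sb : s (fac_index b) = 0 by case: gs => /(_ b) + _; move: nb; case: (s _) => [|[|]].
  rewrite selected_swap //; move: hk; rewrite (cardsD1 a) inE aT aS /= ltnS; apply: leq_trans.
  apply/subset_leq_card/subsetP => f; rewrite !inE => /andP[fT].
  case: eqP => [e|_] /=; first by rewrite e bT' in fT.
  by case/andP => -> ->; rewrite fT.
have [code hc cT] := IH _ (good_swap uF vF gs) bT hk1.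
exists (u + nF cell * (v + nF cell * code)).
  rewrite mulnS expnD -mulnn -mulnA; move: (nF cell ^ (2 * k)) hc => X hc.
  have : v + nF cell * code < nF cell * X by nia.
  by move: (v + _) (nF cell * X) => y z; nia.
have dd x y : x < nF cell -> (x + nF cell * y) %/ nF cell = y.
  by move=> hx; rewrite addnC mulnC divnMDl // divn_small // addn0.
have mm x y : x < nF cell -> (x + nF cell * y) %% nF cell = x.
  by move=> hx; rewrite addnC mulnC modnMDl modn_small.
by rewrite iterSr /swap_step /= !dd // !mm.
Qed.

Lemma balanced_selected_output m : good (m 1) -> feasible (output I m).
Proof.
case=> _ bal; rewrite /feasible; apply/andP; split; apply/eqP.
  rewrite -[kr I]/(quota true) -bal -(card_imset _ (@inl_inj 'I_(nR I) 'I_(nB I))).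
  apply: eq_card => -[i|i]; rewrite !inE ?andbF ?andbT.
    by rewrite (mem_imset _ _ (@inl_inj _ _)) inE.
  by apply/negP => /imsetP[].
rewrite -[kb I]/(quota false) -bal -(card_imset _ (@inr_inj 'I_(nR I) 'I_(nB I))).
apply: eq_card => -[i|i]; rewrite !inE ?andbF ?andbT.
  by apply/negP => /imsetP[].
by rewrite (mem_imset _ _ (@inr_inj _ _)) inE.
Qed.

Local Open Scope ring_scope.

Definition fac_set (x : solution I) : {set Fac} :=
  [set f : Fac | match f with inl i => i \in x.1 | inr i => i \in x.2 end].

Lemma balanced_fac_set x : feasible x -> balanced (fac_set x).
Proof.
case/andP=> /eqP k1 /eqP k2 [] /=.
  rewrite -k1 -(card_imset x.1 (@inl_inj 'I_(nR I) 'I_(nB I))).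
  apply: eq_card => -[i|i]; rewrite !inE ?andbF ?andbT.
    by rewrite (mem_imset _ _ (@inl_inj _ _)).
  by apply/esym/negP => /imsetP[].
rewrite -k2 -(card_imset x.2 (@inr_inj 'I_(nR I) 'I_(nB I))).
apply: eq_card => -[i|i]; rewrite !inE ?andbF ?andbT.
  by apply/esym/negP => /imsetP[].
by rewrite (mem_imset _ _ (@inr_inj _ _)).
Qed.

Lemma fac_set_output m : fac_set (output I m) = selected (m 1%N).
Proof. by apply/setP => -[i|i]; rewrite !inE. Qed.

Lemma fac_set_opened x f : f \in fac_set x -> fac_point f \in opened x.
Proof.
by case: f => i; rewrite inE => ix; apply/setUP; [left | right]; apply: imset_f.
Qed.

Lemma opened_fac_set x y : y \in opened x -> exists2 f, f \in fac_set x & y = fac_point f.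
Proof.
by case/setUP => /imsetP[i ix ->]; [exists (inl i) | exists (inr i)]; rewrite ?inE.
Qed.

Definition fac_cost (A : {set Fac}) : rat :=
  \sum_(j < nC I) min_over A (fun f => dist I (fac_point f) (client j)).

Lemma cost_fac_set x f0 : f0 \in fac_set x -> cost x = fac_cost (fac_set x).
Proof.
move=> hf0; apply: eq_bigr => j _.
have [[f fA eA] hA] := min_overP (fun f => dist I (fac_point f) (client j)) hf0.
have [[y yB eB] hB] := min_overP (fun i => dist I i (client j)) (fac_set_opened hf0).
have [g gA ey] := opened_fac_set yB.
apply: le_anti; apply/andP; split; first by rewrite eA hB // fac_set_opened.
by rewrite eB ey hA.
Qed.

Lemma dvdn_cden k : (k < N * N)%N -> (cell (5 + N * N + k) %| cden cell)%N.
Proof.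
move=> hk; rewrite /cden /common_den nP_cell (bigD1_seq k) /= ?iota_uniq ?mem_index_iota //.
exact: dvdn_mulr.
Qed.

Lemma cden_gt0 : (0 < cden cell)%N.
Proof.
rewrite /cden /common_den nP_cell big_nat_cond prodn_cond_gt0 // => k /andP[/andP[_ hk] _].
have N0 : (0 < N)%N by case: N hk.
pose x := Ordinal (ltn_pmod k N0).
have hy : (k %/ N < N)%N by rewrite ltn_divLR.
rewrite {1}(divn_eq k N) (nth_den (Ordinal hy) x) absz_gt0.
exact: denq_neq0.
Qed.

(** The division in [wt] is exact, since each denominator divides their product. *)
Lemma wtE f (j : 'I_(nC I)) :
  (wt cell (fac_index f) j)%:R = (cden cell)%:R * dist I (fac_point f) (client j).
Proof.
rewrite /wt -[cell 0]/(nC I) -val_fac_point nP_cell.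
have e : j = client j :> nat by [].
rewrite e nth_num.
have hk : ((fac_point f) * N + client j < N * N)%N.
  by have := ltn_ord (fac_point f); have := ltn_ord (client j); nia.
have := dvdn_cden hk; rewrite nth_den => /divnK; move: (cden cell) => D.
set x := dist I _ _; move: (D %/ _)%N => k <-.
rewrite !natrM [LHS]mulrC -[RHS]mulrA; congr (_ * _).
rewrite !natr_absz (ger0_norm (denq_ge0 _)) ger0_norm ?numq_ge0 ?dist_ge0 //.
have ed : (denq x)%:~R != 0 :> rat by rewrite intr_eq0 denq_neq0.
by apply: (mulIf (invr_neq0 ed)); rewrite divq_num_den mulrC mulKf.
Qed.

Lemma best_le_wt s j k f : (f < k)%N -> s f != 0%N -> (best cell s j k <= wt cell f j)%N.
Proof.
elim: k => //= k IH; rewrite ltnS leq_eqVlt => /orP[/eqP-> sk|fk sf].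
  by rewrite sk /=; case: ltnP.
by have := IH fk sf; case: ifP => // /andP[_ /ltnW h]; apply: leq_trans h.
Qed.

Lemma best_attained s j k : best cell s j k = big_wt cell \/
  exists f, [/\ (f < k)%N, s f != 0%N & best cell s j k = wt cell f j].
Proof.
elim: k => [|k IH] /=; first by left.
case: ifP => [/andP[sk _]|_]; first by right; exists k.
case: IH => [|[f [fk sf e]]]; first by left.
by right; exists f; split=> //; apply: ltnW.
Qed.

Lemma wt_le_big f (j : 'I_(nC I)) : (wt cell (fac_index f) j <= big_wt cell)%N.
Proof.
rewrite /wt /big_wt leq_mul ?leq_div //.
have hk : ((nC I + fac_index f) * N + j < N * N)%N.
  rewrite -val_fac_point; have := ltn_ord (fac_point f).
  have := ltn_ord (client j); rewrite /=; nia.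
rewrite /sum_num nP_cell (bigD1_seq ((nC I + fac_index f) * N + j)%N) /= ?iota_uniq ?mem_index_iota //.
exact: leq_addr.
Qed.

(** The initial value [big_wt] is harmless once something is selected: if the minimum stays there,
    the selected [f0] attains it. *)
Lemma costnE s f0 : good s -> f0 \in selected s ->
  (costn cell s)%:R = (cden cell)%:R * fac_cost (selected s).
Proof.
move=> [s1 _] hf0; rewrite /costn -[cell 0]/(nC I) big_mkord natr_sum mulr_sumr.
apply: eq_bigr => j _.
have [[f fA e] hA] := min_overP (fun f => dist I (fac_point f) (client j)) hf0.
have selN g : (g \in selected s) = (s (fac_index g) != 0%N).
  by rewrite inE; case: (s (fac_index g)) (s1 g) => [|[|]].
have [g gS eb] : exists2 g, g \in selected s & best cell s j (nF cell) = wt cell (fac_index g) j.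
  case: (best_attained s j (nF cell)) => [bb|[x [/fac_index_surj[g <-] sx bb]]].
    exists f0 => //; apply/eqP; rewrite eqn_leq best_le_wt ?fac_index_lt -?selN //.
    by rewrite bb wt_le_big.
  by exists g; rewrite // selN.
apply: le_anti; apply/andP; split; last by rewrite eb wtE ler_wpM2l ?ler0n ?hA.
by rewrite e -wtE ler_nat best_le_wt ?fac_index_lt -?selN.
Qed.

Lemma card_ord_lt (l k : nat) : (k <= l)%N -> #|[set i : 'I_l | (i < k)%N]| = k.
Proof.
move=> le_kl; rewrite -sum1_card; under eq_bigl do rewrite inE.
by rewrite (big_ord_narrow le_kl) sum1_card card_ord.
Qed.

Lemma good_first_solution : good (first_solution cell).
Proof.
split=> [f|[]]; first exact: leq_b1.
  rewrite /= -(card_ord_lt (kr_le I)) -(card_imset _ (@inl_inj 'I_(nR I) 'I_(nB I))).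
  apply: eq_card => -[i|i]; rewrite !inE ?andbF ?andbT.
    rewrite (mem_imset _ _ (@inl_inj _ _)) inE /= /first_solution -[cell 3]/(kr I) -[cell 1]/(nR I).
    by rewrite [(nR I <= i)%N]leqNgt ltn_ord /= orbF eqb1.
  by apply/esym/negP => /imsetP[].
rewrite /= -(card_ord_lt (kb_le I)) -(card_imset _ (@inr_inj 'I_(nR I) 'I_(nB I))).
apply: eq_card => -[i|i]; rewrite !inE ?andbF ?andbT.
  by apply/esym/negP => /imsetP[].
rewrite (mem_imset _ _ (@inr_inj _ _)) inE /= /first_solution -[cell 3]/(kr I) -[cell 1]/(nR I) -[cell 4]/(kb I).
rewrite leq_addr ltn_add2l eqb1 /= [(_ < kr I)%N]ltnNge (leq_trans (kr_le I)) //.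
exact: leq_addr.
Qed.

Lemma local_search_ratio (q M : nat) s f0 x :
  (0 < M)%N -> (swap_bound M <= q)%N -> good s -> locally_optimal q M cell s ->
  f0 \in selected s -> feasible x ->
  (M%:R - 6) * fac_cost (selected s) <= (5 * M%:R + 3) * fac_cost (fac_set x).
Proof.
move=> M0 hq gs lo hf0 fx; have [_ bs] := gs; have bx := balanced_fac_set fx.
have F0 : (0 < nF cell)%N by apply: leq_ltn_trans (fac_index_lt f0).
have nonempty (A : {set Fac}) : balanced A -> exists f, f \in A.
  move=> bA; have /card_gt0P[f] : (0 < #|[set f in A | is_red f == is_red f0]|)%N.
    by rewrite bA -bs; apply/card_gt0P; exists f0; rewrite inE hf0 eqxx.
  by rewrite inE => /andP[fA _]; exists f.
have nearest (A : {set Fac}) f1 : f1 \in A -> exists near : 'I_(nC I) -> Fac,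
    (forall j, near j \in A) /\
    fac_cost A = \sum_j dist I (fac_point (near j)) (client j).
  move=> hf1; pose D j f := dist I (fac_point f) (client j).
  have ex (j : 'I_(nC I)) : exists f, (f \in A) && (min_over A (D j) == D j f).
    have [[f fA e] _] := min_overP (D j) hf1.
    by exists f; rewrite fA e eqxx.
  exists (fun j => xchoose (ex j)); split=> [j|].
    by case/andP: (xchooseP (ex j)).
  by apply: eq_bigr => j _; case/andP: (xchooseP (ex j)) => _ /eqP.
have [sg [sgS eS]] := nearest _ _ hf0.
have [f1 hf1] := nonempty _ bx.
have [og [ogO eO]] := nearest _ _ hf1.
rewrite eS eO.
(* A rejected candidate costs at least [1 - 1 / fact] times the current cost, and [fact] exceeds
   [4 M] times the number of facilities. *)
pose eta : rat := (fact M cell)%:R^-1.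
have fact0 : 0 < (fact M cell)%:R :> rat by rewrite ltr0n /fact addn1.
apply: (@local_optimum_bound _ Fac _ _ (fun x y => dist I x y) fac_point (@client I) is_red
  _ _ _ (selected s) (fac_set x) sg og f0 hf0 sgS ogO _ M q eta fac_cost M0 hq).
- exact: dist_ge0.
- exact: dist_sym.
- exact: dist_triangle.
- by move=> c; rewrite bs bx.
- by rewrite invr_ge0 ltW.
- rewrite card_sum !card_ord /eta !mulrA ler_pdivrMr // mul1r -!natrM ler_nat.
  by rewrite /fact nF_cell [(M * 4)%N]mulnC leq_addr.
- move=> T tau hT; apply: ler_sum => j _.
  by have [_] := min_overP (fun f => dist I (fac_point f) (client j)) (hT j); apply.
move=> T hT hq'.
have bT : balanced T by move=> c; rewrite hT bs.
have [code hc eT] := swaps_reach F0 gs bT hq'.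
have gd : good (decode q cell code s).
  by apply: (@Good_decode q cell _ good_swap).
have [f2 hf2] := nonempty _ bT.
have eT' : selected (decode q cell code s) = T by [].
have := lo code hc; rewrite -(ler_nat rat) !natrM (costnE gs hf0).
rewrite (costnE (f0 := f2) gd) ?eT' // -eS.
have D0 : 0 < (cden cell)%:R :> rat by rewrite ltr0n cden_gt0.
rewrite -!mulrA ler_pM2l // => h.
have e1 : (fact M cell).-1%:R = (fact M cell)%:R - 1 :> rat.
  by rewrite /fact addn1 /= -natr1 addrK.
rewrite -(ler_pM2r fact0) mulrAC (_ : (1 - eta) * _ = (fact M cell).-1%:R).
  by rewrite mulrC.
by rewrite e1 mulrBl mul1r /eta mulVf // gt_eqF.
Qed.

Lemma cost_ge0 (x : solution I) : 0 <= cost x.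
Proof.
apply: sumr_ge0 => j _; rewrite /min_over; case: pickP => // y _.
exact: dist_ge0.
Qed.

Lemma local_search_cost (q M : nat) m :
  (6 < M)%N -> (swap_bound M <= q)%N -> good (m 1%N) -> locally_optimal q M cell (m 1%N) ->
  (M%:R - 6) * cost (output I m) <= (5 * M%:R + 3) * OPT I.
Proof.
move=> M6 hq gs lo; have fo := balanced_selected_output gs.
have [[x fx ex] _] := min_overP (@cost I) (fo : output I m \in @feasible I).
rewrite /OPT ex; move: fx => {ex} fx.
have M0 : (0 < M)%N by apply: leq_ltn_trans M6.
have [e|[f0 hf0]] := set_0Vmem (selected (m 1%N)).
  (* With nothing selected both quotas vanish, the feasible solution is unique, and
     [M - 6 <= 5 M + 3] suffices. *)
  have out0 : fac_set (output I m) = set0 by rewrite fac_set_output.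
  have x0 : fac_set x = set0.
    apply/esym; apply: balanced_subset (sub0set _).
      by rewrite -e; case: gs.
    exact: balanced_fac_set.
  have -> : x = output I m.
    have ex : fac_set x = fac_set (output I m) by rewrite x0 out0.
    rewrite [x]surjective_pairing [RHS]surjective_pairing; congr (_, _); apply/setP => i.
      by have /setP/(_ (inl i)) := ex; rewrite !inE.
    by have /setP/(_ (inr i)) := ex; rewrite !inE.
  have h0 : 0 <= M%:R :> rat by rewrite ler0n.
  by apply: ler_wpM2r; [exact: cost_ge0 | lra].
have ho : f0 \in fac_set (output I m) by rewrite fac_set_output.
rewrite (cost_fac_set ho) fac_set_output.
have := local_search_ratio M0 hq gs lo hf0 fx.
suff [f1 hf1] : exists f1, f1 \in fac_set x by rewrite (cost_fac_set hf1).
have /card_gt0P[f1] : (0 < #|[set f in fac_set x | is_red f == is_red f0]|)%N.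
  rewrite balanced_fac_set //; case: gs => _ <-; apply/card_gt0P; exists f0.
  by rewrite inE hf0 eqxx.
by rewrite inE => /andP[h _]; exists f1.
Qed.

Local Close Scope ring_scope.
Local Open Scope nat_scope.

(** Iterations: [n] covers facilities, clients and pairs of points, [n ^ (2 q)] the codes, [q] the
    exchanges, and [16 M n ^ 2 + 2] the passes, as scaled costs have at most [4 n] bits. Bits: [4 n]
    for costs, [2 q n] for codes, [4 M] for the constant in [fact], and the rest is slack. *)
Lemma run_encoded (q M : nat) : 0 < q ->
  runs (n + n ^ (2 * q) + q + 16 * M * (n * n) + 2) ((4 + 2 * q) * n + 4 * M + q + 8)
    (local_search q M) (load w)
    (fun m => good (m 1) /\ locally_optimal q M cell (m 1)).
Proof.
move=> q0; set W := n + _ + _ + _ + _; set V := _ + 8.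
have NN := NN_le; have Nn := N_le; have nF_n : nF cell <= n by rewrite nF_cell; lia.
have lt2 k : k < 2 ^ k by apply: ltn_expl.
have V_of k : k < V -> 2 ^ k < 2 ^ V by rewrite ltn_exp2l.
have nV k : k <= n -> k < 2 ^ V.
  move=> hk; apply: leq_ltn_trans hk _; apply: ltn_trans (lt2 n) (V_of _ _).
  by rewrite /V mulnDl; lia.
have V4 : 4 * n < V by rewrite /V mulnDl; lia.
have cV k : cell k < 2 ^ V.
  by apply: ltn_trans (cell_lt k) (V_of _ _); rewrite /V mulnDl; lia.
have codes_le : codes q cell <= n ^ (2 * q) by rewrite /codes leq_exp2r ?muln_gt0.
apply: (@run_local_search q M cell W V _ _ _ _ _ _ _ _ _ _ q0 good good_agree good_swap (4 * n)).
- by rewrite /V addnS.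
- by rewrite /W; lia.
- exact: nV.
- by rewrite -[cell 0]/(nC I) /W; lia.
- exact: cV.
- by rewrite /W; lia.
- by apply: ltn_trans (lt2 q) (V_of _ _); rewrite /V; lia.
- by rewrite /W; lia.
- apply: leq_ltn_trans codes_le _; apply: leq_ltn_trans (_ : 2 ^ (n * (2 * q)) < _).
    by rewrite [2 ^ (_ * _)]expnM leq_exp2r ?muln_gt0 // ltnW.
  by apply: V_of; rewrite /V mulnDl mulnC; lia.
- apply: leq_ltn_trans nC_big_wt (V_of _ V4).
- have := nC_big_wt; rewrite -[cell 0]/(nC I); have : 0 < big_wt cell \/ big_wt cell = 0 by lia.
  case=> [b0|b0]; first by lia.
  by rewrite b0 muln0 expn_gt0.
- have : 4 * M * nF cell * (4 * n) <= 16 * M * (n * n).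
    rewrite (_ : 16 * M * (n * n) = 4 * M * n * (4 * n)); last by ring.
    by rewrite leq_mul2r leq_mul2l nF_n !orbT.
  by rewrite /W; lia.
- exact: nV.
- by rewrite nP_cell /W; lia.
- exact: nV.
- move=> k hk; apply: leq_ltn_trans (sum_num_le hk) (V_of _ _); rewrite /V mulnDl; lia.
- move=> k hk; apply: leq_ltn_trans (common_den_le hk) (V_of _ _); rewrite /V mulnDl; lia.
- by rewrite -[cell 3]/(kr I) /W; have := kr_le I; lia.
- exact: cV.
- by rewrite -[cell 4]/(kb I) /W; have := kb_le I; lia.
- exact: cV.
- rewrite /fact; apply: leq_ltn_trans (_ : 2 ^ (4 * M) * 2 ^ n < _).
    have := lt2 (4 * M); have : nF cell < 2 ^ n by apply: leq_ltn_trans nF_n (lt2 n).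
    by move: (2 ^ n) (2 ^ (4 * M)) => a b; nia.
  by rewrite -expnD; apply: V_of; rewrite /V mulnDl; lia.
- by move=> a i; rewrite /load; case: ifP => _; [exact: cV | rewrite expn_gt0].
- by [].
- by move=> a i /negbTE ha; rewrite /load ha.
exact: good_first_solution.
Qed.

End Encoded.

Lemma swap_bound_gt0 (M : nat) : 0 < swap_bound M.
Proof. by rewrite /swap_bound /block_bound muln_gt0. Qed.

Lemma local_search_poly (q M : nat) :
  let sz I := input_size (encode I) in
  poly_bounded sz (fun I => time_bound
    (sz I + sz I ^ (2 * q) + q + 16 * M * (sz I * sz I) + 2)
    ((4 + 2 * q) * sz I + 4 * M + q + 8) (local_search q M)).
Proof.
move=> sz; have pz := poly_bounded_size sz; have pc := @poly_bounded_const _ sz.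
apply: poly_bounded_time; do ?apply: poly_bounded_add => //.
- exact: poly_bounded_exp.
- by do 2?apply: poly_bounded_mul.
- exact: poly_bounded_mul.
Qed.

Local Close Scope nat_scope.
Local Open Scope ring_scope.

Theorem theorem2 (R : realType) (eps : R) (eps_gt0 : 0 < eps) :
  exists (p : cmd) (c k : nat), forall I : instance,
  exists (t : nat) (m : memory),
    [/\ exec p (load (encode I)) t m,
        (t <= c * input_size (encode I) ^ k + c)%N,
        feasible (output I m)
      & ratr (cost (output I m)) <= (5 + eps) * ratr (OPT I)].
Proof.
(* Since [(5 M + 3) / (M - 6) = 5 + 33 / (M - 6)], it suffices that [M - 6] reaches [33 / eps]. *)
pose M := (7 + Num.bound (33 / eps))%N; pose q := swap_bound M.
have [c [k hck]] := local_search_poly q M.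
exists (local_search q M), c, k => I.
have [t [m [ex le_t _ [gm lm]]]] := run_encoded I M (swap_bound_gt0 M).
exists t, m; split=> //; first exact: leq_trans le_t (hck I).
  exact: balanced_selected_output.
have := local_search_cost (isT : (6 < M)%N) (leqnn q) gm lm.
have -> : M%:R - 6 = (M - 6)%N%:R :> rat by rewrite natrB.
have -> : 5 * M%:R + 3 = (5 * M + 3)%N%:R :> rat by rewrite natrD natrM.
rewrite -(ler_rat R) !rmorphM /= !ratr_nat natrB // natrD natrM => h.
have e0 : 0 <= 33 / eps by rewrite divr_ge0 // ltW.
have hM : 33 / eps + 1 < M%:R - 6.
  by have := archi_boundP e0; rewrite /M natrD; lra.
have he : 33 <= eps * (M%:R - 6).
  by rewrite mulrC -ler_pdivrMr //; lra.
have O0 : 0 <= ratr (OPT I) :> R.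
  rewrite ler0q /OPT.
  have [[x _ ->] _] := min_overP (@cost I) (balanced_selected_output gm : output I m \in @feasible I).
  exact: cost_ge0.
have M6 : 0 < M%:R - 6 :> R by lra.
rewrite -(ler_pM2l M6) [leRHS]mulrA; apply: le_trans h _; apply: ler_wpM2r => //.
by lra.
Qed.
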